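(* Let $d,\ell,n$ be positive integers with $n\geqslant\ell\geqslant 2d$, let $0<\beta\leqslant1$, and let $\boldsymbol{X}$ be a $d$-dimensional random array on $[n]$ which is $(\beta,\ell)$-dissociated and whose entries take values in a measurable space $\mathcal{X}$. Then for every $1<p\leqslant2$, every measurable $f\colon\mathcal{X}^{\binom{[n]}{d}}\to\mathbb{R}$ with $f(\boldsymbol{X})\in L_p$, every integer $k$ with $d\leqslant k\leqslant\lfloor\ell/2\rfloor$, and every $I\in\binom{[n]}{\ell}$, there exists $J\in\binom{I}{k}$ such that for every $1\leqslant r<p$, \[ \big\|\mathbb{E}[f(\boldsymbol{X})\,|\,\mathcal{F}_J]-\mathbb{E}[f(\boldsymbol{X})]\big\|_{L_r}\leqslant\Big((p-1)^{-1/2}\sqrt{\frac{2k}{\ell}}+10\,\beta^{\frac1r-\frac1p}\Big)\big\|f(\boldsymbol{X})-\mathbb{E}[f(\boldsymbol{X})]\big\|_{L_p}. \] Moreover, if $I$ is an interval of $[n]$, then $J$ can be taken to be an interval too.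
   Context: $[n]=\{1,\dots,n\}$, $\binom{I}{d}$ is the set of $d$-element subsets of $I$. A $d$-dimensional random array on $[n]$ is a stochastic process $\boldsymbol{X}=\langle X_s:s\in\binom{[n]}{d}\rangle$; for $J\subseteq[n]$ with $|J|\geqslant d$, $\mathcal{F}_J=\sigma(\{X_s:s\in\binom{J}{d}\})$. For $n\geqslant\ell\geqslant2d$ and $0\leqslant\beta\leqslant1$, $\boldsymbol{X}$ is $(\beta,\ell)$-dissociated if for every $J,K\subseteq[n]$ with $|J|,|K|\geqslant d$, $|J|+|K|\leqslant\ell$ and $\max(J)<\min(K)$, and all events $A\in\mathcal{F}_J$, $B\in\mathcal{F}_K$, we have $|\mathbb{P}(A\cap B)-\mathbb{P}(A)\mathbb{P}(B)|\leqslant\beta$. An interval is a set of consecutive integers. *)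

(* Defs.v *)
From HB Require Import structures.
From mathcomp Require Import all_boot all_order all_algebra.
From mathcomp Require Import all_classical all_reals all_analysis.
Set Implicit Arguments. Unset Strict Implicit. Unset Printing Implicit Defensive.
Import Order.TTheory GRing.Theory Num.Theory.
Local Open Scope classical_set_scope.
Local Open Scope ring_scope.

(* d-element subsets of [n] = {0,...,n-1} (i.e. 'I_n; the shift by one
   preserves order, maxima/minima and intervals). *)
Definition dsub (n d : nat) := {s : {set 'I_n} | #|s| == d}.

Definition gen_sigma {I aT : Type} {dr} {rT : measurableType dr}
  (P : set I) (f : I -> aT -> rT) : set (set aT) :=
  <<s \bigcup_(i in P) preimage_set_system setT (f i) measurable >>.

Definition FJ {n d : nat} {aT : Type} {dr} {rT : measurableType dr}
  (X : dsub n d -> aT -> rT) (J : {set 'I_n}) : set (set aT) :=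
  gen_sigma [set s : dsub n d | val s \subset J] X.

Definition prod_sigma {n d : nat} {dr} (rT : measurableType dr) :
  set (set (dsub n d -> rT)) :=
  gen_sigma setT (fun (s : dsub n d) (x : dsub n d -> rT) => x s).

Definition prod_measurable {n d : nat} {dr} {rT : measurableType dr}
  {R : realType} (f : (dsub n d -> rT) -> R) : Prop :=
  forall B : set R, measurable B -> @prod_sigma n d dr rT (f @^-1` B).

Definition dissociated {R : realType} {dT} {T : measurableType dT}
  (P : probability T R) {n d : nat} {dr} {rT : measurableType dr}
  (X : dsub n d -> T -> rT) (beta : R) (l : nat) : Prop :=
  forall J K : {set 'I_n},
    (d <= #|J|)%N -> (d <= #|K|)%N -> (#|J| + #|K| <= l)%N ->
    (forall j k, j \in J -> k \in K -> (j < k)%N) ->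
    forall A B : set T, FJ X J A -> FJ X K B ->
      `| fine (P (A `&` B)) - fine (P A) * fine (P B) | <= beta.

Definition is_cond_exp {R : realType} {dT} {T : measurableType dT}
  (P : probability T R) (G : set (set T)) (Z Y : T -> R) : Prop :=
  [/\ forall B : set R, measurable B -> G (Y @^-1` B),
      P.-integrable setT (EFin \o Y) &
      forall A, G A -> (\int[P]_(x in A) (Y x)%:E = \int[P]_(x in A) (Z x)%:E)%E].

Definition int_interval {n : nat} (J : {set 'I_n}) : Prop :=
  forall i j k : 'I_n, i \in J -> k \in J -> (i <= j)%N -> (j <= k)%N -> j \in J.

(* Main.v *)
Require Import Defs.
From HB Require Import structures.
From mathcomp Require Import all_boot all_order all_algebra.
From mathcomp Require Import all_classical all_reals all_analysis.
From mathcomp Require Import measurable_realfun ring lra.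
Set Implicit Arguments. Unset Strict Implicit. Unset Printing Implicit Defensive.
Import Order.TTheory GRing.Theory Num.Theory.
Import numFieldNormedType.Exports.
Local Open Scope classical_set_scope.
Local Open Scope ring_scope.

(* Cut I into m = l %/ k consecutive blocks J_0 < J_1 < ... of size k and let
   K_i be the union of the blocks before J_i.  The conditional expectations E_i
   of Z - E Z given F_(K_i) form a martingale, and the uniform convexity of L_p,
   |Y|_p^2 + (p - 1) |Z - Y|_p^2 <= |Z|_p^2 for Y = E[Z | G], bounds the sum of the
   squared L_p norms of its increments, so some increment has norm at most
   ((p - 1) m)^(-1/2) |Z - E Z|_p, where 1 / m <= 2 k / l.  Conditioning on the
   block J_i, E[Z | F_(J_i)] - E Z is the conditional expectation of that
   increment plus that of E_i.  The latter is F_(K_i)-measurable, hence nearly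
   independent of F_(J_i): truncating E_i at height |Z - E Z|_p beta^(-1/p)
   gives a contribution of 6 beta^(1/r - 1/p) |Z - E Z|_p. *)

(** * Power inequalities *)

(** The index [i] is chosen from the L_p norms of the increments alone, before [r] and the version
    [Y] are given, so one block serves every r < p. Since J_i lies in K_(i+1), conditioning E_(i+1)
    on F_(J_i) gives back E[Z - E Z | F_(J_i)], and the increment only shrinks in L_p. For p < 2 the
    increments are not orthogonal. The substitute comes from a two-point inequality for real
    numbers, lifted to functions by the reverse Minkowski inequality in L_(p/2), where p / 2 <= 1.
    The mixing hypothesis speaks of events only and says nothing direct about unbounded functions,
    hence the truncation. At height M, with m = M beta^(1/r), the bounded part costs 4 m, the tail m
    and the mean of the truncated function m, which is the 6. The height balances these costs: M^p
    beta is the p-th moment of Z - E Z, which makes the tail of the same order as the bounded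
    part. *)

Section power_inequalities.
Context {R : realType}.
Implicit Types (p q x y a b u v w : R).

Lemma powR_invK q a : 0 < q -> 0 <= a -> (a `^ q^-1) `^ q = a.
Proof. by move=> q0 a0; rewrite -powRrM mulVf ?gt_eqF// powRr1. Qed.

(** Young's inequality for y and x^(p - 1), with conjugate exponents p and p / (p - 1), rearranges
    to the tangent line of t^p at x. At p = 1 there is no finite conjugate exponent, hence the
    separate case. *)
Lemma powR_tangent p x y : 1 <= p -> 0 <= x -> 0 <= y ->
  x `^ p + p * x `^ (p - 1) * (y - x) <= y `^ p.
Proof.
rewrite le_eqVlt => /predU1P[<- x0 y0|p1 x0 y0].
  by rewrite subrr powRr0 !powRr1//; lra.
have p0 : 0 < p by lra.
have xp : x `^ (p - 1) * x = x `^ p by rewrite mulrC mulr_powRB1.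
have := @conjugate_powR _ y (x `^ (p - 1)) p (p / (p - 1)) y0 (powR_ge0 _ _).
rewrite -powRrM mulrCA divff ?subr_eq0 ?gt_eqF// mulr1 invf_div => Y.
have {}Y : y * x `^ (p - 1) <= y `^ p / p + x `^ p * ((p - 1) / p).
  by apply: Y => //; [rewrite divr_gt0// subr_gt0|rewrite mulrBl divff ?gt_eqF//; lra].
have : p * (y * x `^ (p - 1)) <= y `^ p + (p - 1) * x `^ p.
  rewrite -(ler_pM2l p0) in Y; apply: (le_trans Y).
  by rewrite le_eqVlt; apply/orP; left; apply/eqP; field; rewrite gt_eqF.
by move: xp; nra.
Qed.

(** The factor p sg(x) |x|^(p - 1) is a subgradient of |x|^p, in the form that conditional Jensen
    takes. The bound is the tangent at |x|, because sg(x) y <= |y|. *)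
Lemma powR_normr_tangent p x y : 1 <= p ->
  `|x| `^ p + p * Num.sg x * `|x| `^ (p - 1) * (y - x) <= `|y| `^ p.
Proof.
move=> p1; apply: le_trans (powR_tangent p1 (normr_ge0 x) (normr_ge0 y)).
rewrite lerD2l -2!mulrA -mulrA ler_wpM2l//; first lra.
rewrite mulrCA ler_wpM2l ?powR_ge0// mulrBr -normrEsg lerB//.
by rewrite (le_trans (ler_norm _))// normrM normr_sg ler_piMl// lern1 leq_b1.
Qed.

Lemma powR_convex p u x y : 1 <= p -> 0 <= u <= 1 -> 0 <= x -> 0 <= y ->
  (u * x + (1 - u) * y) `^ p <= u * x `^ p + (1 - u) * y `^ p.
Proof.
move=> p1 /andP[u0 u1] x0 y0.
by apply: (convex_powR p1 (Itv01 u0 u1)); rewrite ?inE/= ?in_itv/= ?andbT.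
Qed.

(** Convexity of t^(1/q) at x^q and y^q, raised to the power q. *)
Lemma powR_concave q u x y : 0 < q <= 1 -> 0 <= u <= 1 -> 0 <= x -> 0 <= y ->
  u * x `^ q + (1 - u) * y `^ q <= (u * x + (1 - u) * y) `^ q.
Proof.
move=> /andP[q0 q1] /andP[u0 u1] x0 y0.
have qV : 1 <= q^-1 by rewrite invf_ge1.
have := @powR_convex q^-1 u (x `^ q) (y `^ q) qV.
rewrite u0 u1 !powR_ge0 => /(_ isT isT isT).
rewrite -!powRrM mulfV ?gt_eqF// !powRr1// => H.
have L0 : 0 <= u * x `^ q + (1 - u) * y `^ q.
  by rewrite addr_ge0 ?mulr_ge0 ?powR_ge0//; lra.
rewrite -[leLHS](powR_invK q0)// ge0_ler_powR ?nnegrE ?powR_ge0//; first lra.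
by rewrite addr_ge0 ?mulr_ge0//; lra.
Qed.

(* Weighting by A and B turns the reverse Minkowski inequality in L_q, q <= 1,
   into a pointwise bound whose integral is [(A + B) `^ q] when A and B are the
   L_q quasi-norms of u and v. *)
Lemma powR_superadditive q A B u v : 0 < q <= 1 -> 0 < A -> 0 < B ->
  0 <= u -> 0 <= v ->
  (A + B) `^ q * (A / (A + B) * (u `^ q / A `^ q) +
                  B / (A + B) * (v `^ q / B `^ q)) <= (u + v) `^ q.
Proof.
move=> q01 A0 B0 u0 v0.
have AB0 : 0 < A + B by rewrite addr_gt0.
have E1 : 1 - A / (A + B) = B / (A + B) by field; rewrite gt_eqF.
have H := @powR_concave q (A / (A + B)) (u / A) (v / B) q01.
have {}H : A / (A + B) * (u / A) `^ q + B / (A + B) * (v / B) `^ q <=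
    (A / (A + B) * (u / A) + B / (A + B) * (v / B)) `^ q.
  rewrite -E1; apply: H; [|exact: divr_ge0 (ltW _)..].
  by rewrite divr_ge0 ?(ltW A0) ?(ltW AB0)// ler_pdivrMr// mul1r lerDl ltW.
have E2 : A / (A + B) * (u / A) + B / (A + B) * (v / B) = (u + v) / (A + B).
  by field; rewrite !gt_eqF.
have P c d : 0 <= c -> 0 < d -> (c / d) `^ q = c `^ q / d `^ q.
  move=> c0 d0; apply: (mulIf (lt0r_neq0 (powR_gt0 q d0))).
  by rewrite -powRM ?divr_ge0 ?(ltW d0)// !divfK ?gt_eqF ?powR_gt0.
rewrite E2 !P// ?addr_ge0// in H.
by rewrite mulrC -ler_pdivlMr ?powR_gt0.
Qed.

(** The tangent of t^(1/q) at 1, read at 1 + q u, gives 1 + u <= (1 + q u)^(1/q). *)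
Lemma powR_bernoulli q u : 0 < q <= 1 -> 0 <= u -> (1 + u) `^ q <= 1 + q * u.
Proof.
move=> /andP[q0 q1] u0.
have qu0 : 0 <= q * u by rewrite mulr_ge0// ltW.
have := @powR_tangent q^-1 1 (1 + q * u).
rewrite invf_ge1// q1 ler01 addr_ge0// !powR1 mulr1 => /(_ isT isT isT).
rewrite (_ : 1 + q * u - 1 = q * u); last lra.
rewrite mulrA mulVf ?gt_eqF// mul1r => H.
rewrite -[leRHS](powR_invK q0) ?addr_ge0//.
by rewrite ge0_ler_powR ?nnegrE ?powR_ge0 ?addr_ge0// ltW.
Qed.

(** * The two-point inequality for p-th powers of real numbers *)

Lemma is_derive_powR_shift a c x : 0 < 1 + c * x ->
  is_derive x 1 (fun y => (1 + c * y) `^ a) (a * (1 + c * x) `^ (a - 1) * c).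
Proof.
move=> x0.
have H : is_derive x 1 (fun y => 1 + c * y) c.
  by apply: is_derive_eq; rewrite /GRing.scale/=; ring.
have H2 := @is_derive1_powR _ a _ x0.
have := @is_derive1_comp R (fun z : R => z `^ a) (fun y : R => 1 + c * y) x _ _ H2 H.
exact.
Qed.

(** The difference of the two sides has derivative a ((1 + x)^(a - 1) + (1 - x)^(a - 1) - 2). The
    two powers have product (1 - x^2)^(a - 1) >= 1, as a <= 1, so their sum is at least 2. *)
Lemma powR_two_point_incr a y : 0 < a <= 1 -> 0 <= y < 1 ->
  2 * a * y <= (1 + y) `^ a - (1 - y) `^ a.
Proof.
move=> /andP[a0 a1] /andP[y0 y1].
pose f y := (1 + 1 * y) `^ a - (1 + (-1) * y) `^ a - 2 * a * y.
have df x : 0 <= x <= y -> is_derive x 1 f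
    (a * (1 + 1 * x) `^ (a - 1) * 1 - a * (1 + (-1) * x) `^ (a - 1) * (-1) - 2 * a).
  move=> /andP[x0 xy].
  have H1 : is_derive x 1 (fun y => (1 + 1 * y) `^ a) (a * (1 + 1 * x) `^ (a - 1) * 1).
    by apply: is_derive_powR_shift; lra.
  have H2 : is_derive x 1 (fun y => (1 + (-1) * y) `^ a) (a * (1 + (-1) * x) `^ (a - 1) * (-1)).
    by apply: is_derive_powR_shift; lra.
  by apply: is_derive_eq; rewrite /GRing.scale/=; ring.
suff : f 0 <= f y by rewrite /f !mulr0 !addr0 mul1r mulN1r powR1; lra.
apply: (@ger0_derive1_ndecr _ f 0 y) => // [x|x|].
- rewrite in_itv/= => /andP[x0 xy].
  by have /df[] : 0 <= x <= y by lra.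
- rewrite in_itv/= => /andP[x0 xy].
  have /df[_] : 0 <= x <= y by lra.
  rewrite derive1E => ->; rewrite mul1r mulN1r.
  set s := (1 + x) `^ _; set t := (1 - x) `^ _.
  have s0 : 0 < s by rewrite powR_gt0; lra.
  have t0 : 0 < t by rewrite powR_gt0; lra.
  have st : 1 <= s * t.
    rewrite /s /t -powRM; [|lra|lra].
    rewrite -[leLHS](powRr0 ((1 + x) * (1 - x))) ger_powR//; last lra.
    rewrite (_ : (1 + x) * (1 - x) = 1 - x * x); last ring.
    by rewrite subr_gt0 gerBl mulr_ge0 ?ltW// andbT; nra.
  have : 2 <= s + t.
    rewrite leNgt; apply/negP => h.
    have : 0 < (2 - (s + t)) * (2 + (s + t)) by rewrite mulr_gt0; lra.
    by have := sqr_ge0 (s - t); rewrite expr2; nra.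
  by move: s t {st s0 t0} => s t; nra.
- apply: derivable_within_continuous => x; rewrite in_itv/= => xy.
  by have [] := df _ xy.
Qed.

(** The derivative in y of the difference of the two sides is p times the defect in
    [powR_two_point_incr] for a = p - 1. *)
Lemma powR_two_point_quadratic p y : 1 < p <= 2 -> 0 <= y < 1 ->
  2 + p * (p - 1) * y ^+ 2 <= (1 + y) `^ p + (1 - y) `^ p.
Proof.
move=> /andP[p1 p2] /andP[y0 y1].
pose f y := (1 + 1 * y) `^ p + (1 + (-1) * y) `^ p - p * (p - 1) * (y * y).
have df x : 0 <= x <= y -> is_derive x 1 f
    (p * (1 + 1 * x) `^ (p - 1) * 1 + p * (1 + (-1) * x) `^ (p - 1) * (-1) - 2 * p * (p - 1) * x).
  move=> /andP[x0 xy].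
  have H1 : is_derive x 1 (fun y => (1 + 1 * y) `^ p) (p * (1 + 1 * x) `^ (p - 1) * 1).
    by apply: is_derive_powR_shift; lra.
  have H2 : is_derive x 1 (fun y => (1 + (-1) * y) `^ p) (p * (1 + (-1) * x) `^ (p - 1) * (-1)).
    by apply: is_derive_powR_shift; lra.
  by apply: is_derive_eq; rewrite /GRing.scale/=; ring.
suff : f 0 <= f y by rewrite /f !mulr0 !addr0 mul1r mulN1r powR1 expr2; lra.
apply: (@ger0_derive1_ndecr _ f 0 y) => // [x|x|].
- rewrite in_itv/= => /andP[x0 xy].
  by have /df[] : 0 <= x <= y by lra.
- rewrite in_itv/= => /andP[x0 xy].
  have /df[_] : 0 <= x <= y by lra.
  rewrite derive1E => ->; rewrite mul1r mulN1r.
  have : 2 * (p - 1) * x <= (1 + x) `^ (p - 1) - (1 - x) `^ (p - 1).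
    by apply: powR_two_point_incr; lra.
  by nra.
- apply: derivable_within_continuous => x; rewrite in_itv/= => xy.
  by have [] := df _ xy.
Qed.

(** Bernoulli's inequality with exponent p / 2 puts the left side below 2 + p (p - 1) y^2. The
    derivative argument stops short of y = 1, where the base 1 - y vanishes. *)
Lemma powR_two_point_norm p y : 1 < p <= 2 -> 0 <= y <= 1 ->
  2 * (1 + (p - 1) * y ^+ 2) `^ (p / 2) <= (1 + y) `^ p + (1 - y) `^ p.
Proof.
move=> p12 /andP[y0]; have /andP[p1 p2] := p12.
have Q z : 0 <= z -> 2 * (1 + (p - 1) * z ^+ 2) `^ (p / 2) <= 2 + p * (p - 1) * z ^+ 2.
  move=> z0; have := @powR_bernoulli (p / 2) ((p - 1) * z ^+ 2).
  have z2 := sqr_ge0 z.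
  have -> : (0 < p / 2 <= 1) by lra.
  by rewrite mulr_ge0//; [move=> /(_ isT isT); nra|lra].
rewrite le_eqVlt => /predU1P[->|y1]; last first.
  by apply: le_trans (Q _ y0) _; apply: powR_two_point_quadratic; rewrite ?y0.
apply: le_trans (Q 1 ler01) _.
rewrite subrr powR0 ?gt_eqF//; last lra.
rewrite expr1n mulr1 addr0; apply/ler_addgt0Pr => e e0.
(* The bound at 1 is the limit of the bound at 1 - s as s tends to 0. *)
pose s := Num.min (2^-1) (e / 8).
have s0 : 0 < s by rewrite lt_min; lra.
have s1 : s <= 2^-1 by rewrite ge_min lexx.
have s2 : s <= e / 8 by rewrite ge_min lexx orbT.
have H : 2 + p * (p - 1) * (1 - s) ^+ 2 <= (1 + (1 - s)) `^ p + (1 - (1 - s)) `^ p.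
  by apply: powR_two_point_quadratic => //; lra.
have H1 : (1 + (1 - s)) `^ p <= (1 + 1) `^ p.
  by rewrite ge0_ler_powR ?nnegrE; lra.
have H2 : (1 - (1 - s)) `^ p <= s.
  rewrite (_ : 1 - (1 - s) = s); last lra.
  by rewrite ge1r_powR//; lra.
(* Moving from 1 to 1 - s loses at most [s] by [H2] and 2 s p (p - 1) <= 4 s in the quadratic term;
   s <= e / 8 absorbs both. *)
have H3 : p * (p - 1) <= 2 by nra.
have H4 : 0 <= p * (p - 1) by nra.
by move: H; rewrite expr2; nra.
Qed.

(** By homogeneity only y = b / a in [0, 1] matters. Sign changes permute the right side, and
    exchanging a and b when |a| <= |b| only increases the left side, since p - 1 <= 1. *)
Lemma powR_two_point p a b : 1 < p <= 2 ->
  2 * (a ^+ 2 + (p - 1) * b ^+ 2) `^ (p / 2) <= `|a + b| `^ p + `|a - b| `^ p.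
Proof.
move=> p12; have /andP[p1 p2] := p12.
wlog ab : a b / `|b| <= `|a|.
  move=> W; have [|/ltW ba] := leP `|b| `|a|; first exact: W.
  have := W b a ba; rewrite distrC (addrC b a); apply: le_trans.
  rewrite ler_pM2l// ge0_ler_powR ?nnegrE; [|lra|nra|nra|].
    by have := sqr_ge0 a; have := sqr_ge0 b; nra.
  by move: ba; rewrite -ler_sqr ?nnegrE// !real_normK ?num_real//; nra.
wlog a0 : a b ab / 0 <= a.
  move=> W; have [|/ltW a0] := leP 0 a; first exact: W.
  have E1 : `|- a - b| = `|a + b| by rewrite -opprD normrN.
  have E2 : `|- a - - b| = `|a - b| by rewrite opprK addrC distrC.
  have := W (- a) (- b); rewrite E1 E2 !normrN !sqrrN.
  by apply => //; rewrite oppr_ge0.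
wlog b0 : b ab / 0 <= b.
  move=> W; have [|/ltW b0] := leP 0 b; first exact: W.
  have := W (- b); rewrite normrN sqrrN opprK (addrC (`|a - b| `^ p)).
  by apply => //; rewrite oppr_ge0.
rewrite !ger0_norm// in ab.
have [a00|a00] := eqVneq a 0.
  have -> : b = 0 by lra.
  rewrite a00 (_ : 0 ^+ 2 + (p - 1) * 0 ^+ 2 = 0); last ring.
  by rewrite powR0 ?mulr0 ?addr_ge0 ?powR_ge0// gt_eqF//; lra.
have {a00}a0' : 0 < a by rewrite lt0r a00.
have := @powR_two_point_norm p (b / a) p12.
rewrite divr_ge0// ler_pdivrMr// mul1r ab => /(_ isT).
have ap : 0 < a `^ p by rewrite powR_gt0.
rewrite -(ler_pM2l ap) mulrDr -!powRM//; last 2 first.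
- by rewrite subr_ge0 ler_pdivrMr// mul1r.
- by rewrite addr_ge0// divr_ge0.
have E : a * (b / a) = b by rewrite mulrC divfK ?gt_eqF.
rewrite (mulrDr a) (mulrBr a) mulr1 E.
rewrite !ger0_norm ?subr_ge0 ?addr_ge0//; apply: le_trans.
rewrite le_eqVlt; apply/orP; left; apply/eqP.
have -> : a `^ p = (a ^+ 2) `^ (p / 2).
  by rewrite -powR_mulrn// -powRrM; congr (_ `^ _); field.
rewrite [RHS]mulrCA -powRM ?sqr_ge0//; last first.
  by rewrite addr_ge0// mulr_ge0 ?sqr_ge0//; lra.
by congr (_ * _ `^ _); field; rewrite gt_eqF.
Qed.

End power_inequalities.

(** * Expectation and conditional expectation *)

Section expectation.
Context {R : realType} {d} {T : measurableType d} (P : probability T R).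
Implicit Types (f g h : T -> R) (A : set T).

Local Notation L1 f := (P.-integrable [set: T] (EFin \o f)).
Local Notation E f := (\int[P]_x f x).

Lemma integrable_measurable f : L1 f -> measurable_fun [set: T] f.
Proof. by move=> /(measurable_int P)/measurable_EFinP. Qed.

Lemma integrable_addr f g : L1 f -> L1 g -> L1 (fun x => f x + g x).
Proof. exact: integrableD. Qed.

Lemma integrable_subr f g : L1 f -> L1 g -> L1 (fun x => f x - g x).
Proof. exact: integrableB. Qed.

Lemma integrable_scaler (a : R) f : L1 f -> L1 (fun x => a * f x).
Proof. exact: integrableZl. Qed.

Lemma integrable_const (a : R) : L1 (fun=> a).
Proof. exact: finite_measure_integrable_cst. Qed.

Lemma integrable_normr f : L1 f -> L1 (fun x => `|f x|).
Proof. exact: integrable_norm. Qed.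

Lemma integrable_dominated f g : measurable_fun [set: T] f ->
  (forall x, `|f x| <= g x) -> L1 g -> L1 f.
Proof.
move=> mf fg ig; apply: (le_integrable measurableT _ _ ig).
  exact/measurable_EFinP.
by move=> x _ /=; rewrite lee_fin (le_trans (fg x))// ler_norm.
Qed.

Lemma integrable_bounded f (M : R) : measurable_fun [set: T] f ->
  (forall x, `|f x| <= M) -> L1 f.
Proof. by move=> mf fM; apply: (integrable_dominated mf fM (integrable_const M)). Qed.

Lemma integrable_bounded_mul h f (M : R) : measurable_fun [set: T] h ->
  (forall x, `|h x| <= M) -> L1 f -> L1 (fun x => h x * f x).
Proof.
move=> mh hM iF.
apply: (@integrable_dominated _ (fun x => M * `|f x|)).
- by apply: measurable_funM => //; exact: integrable_measurable.
- by move=> x; rewrite normrM ler_wpM2r.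
- exact/integrable_scaler/integrable_normr.
Qed.

Lemma normr_indic_le1 A x : `|\1_A x : R| <= 1.
Proof. by rewrite indicE; case: (x \in A); rewrite ?normr1 ?normr0. Qed.

Lemma integrable_indic_mul A f : measurable A -> L1 f -> L1 (fun x => \1_A x * f x).
Proof.
move=> mA; apply: (@integrable_bounded_mul _ _ 1); first exact: measurable_indic.
exact: normr_indic_le1.
Qed.

Lemma expectD f g : L1 f -> L1 g -> E (fun x => f x + g x) = E f + E g.
Proof. exact: RintegralD. Qed.

Lemma expectB f g : L1 f -> L1 g -> E (fun x => f x - g x) = E f - E g.
Proof. exact: RintegralB. Qed.

Lemma expectZ (a : R) f : L1 f -> E (fun x => a * f x) = a * E f.
Proof. exact: RintegralZl. Qed.

Lemma expect_cst (a : R) : E (fun=> a) = a.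
Proof.
rewrite (Rintegral_cst P)//.
by apply: etrans (mulr1 a); congr (a * _); exact: (congr1 fine (probability_setT P)).
Qed.

Lemma expect_le f g : L1 f -> L1 g -> (forall x, f x <= g x) -> E f <= E g.
Proof. by move=> iF ig fg; apply: le_Rintegral => // x _. Qed.

Lemma expect_ge0 f : (forall x, 0 <= f x) -> 0 <= E f.
Proof. by move=> f0; apply: Rintegral_ge0 => x _. Qed.

Lemma expect_norm_le f : L1 f -> `|E f| <= E (fun x => `|f x|).
Proof. exact: le_normr_Rintegral. Qed.

Lemma expect_EFin f : L1 f -> (\int[P]_x (f x)%:E)%E = (E f)%:E.
Proof. by move=> iF; rewrite fineK//; apply: integrable_fin_num. Qed.

Lemma integral_indic_mul A f : measurable A -> L1 f ->
  (\int[P]_(x in A) (f x)%:E)%E = (E (fun x => \1_A x * f x))%:E.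
Proof.
move=> mA iF; rewrite -expect_EFin; last exact: integrable_indic_mul.
rewrite integral_mkcond; apply: eq_integral => x _.
rewrite patchE indicE; case: (x \in A); rewrite ?mul1r ?mul0r//.
Qed.

Lemma expect_indic A : measurable A -> E (\1_A) = fine (P A).
Proof. by move=> mA; rewrite /Rintegral integral_indic// setIT. Qed.

End expectation.

Section conditional_expectation.
Context {R : realType} {d} {T : measurableType d} (P : probability T R).
Variable G : set (set T).
Hypothesis subG : <<s G >> `<=` measurable.
Implicit Types (f g h Y Z : T -> R).

Local Notation TG := (g_sigma_algebraType G).
Local Notation L1 f := (P.-integrable [set: T] (EFin \o f)).
Local Notation E f := (\int[P]_x f x).
Local Notation Gmeas f := (measurable_fun [set: TG] (f : TG -> R)).

Lemma sub_measurable_fun f : Gmeas f -> measurable_fun [set: T] f.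
Proof. by move=> mf _ B mB; apply: subG; exact: mf. Qed.

Lemma cond_exp_measurable Z Y : is_cond_exp P <<s G >> Z Y -> Gmeas Y.
Proof. by case=> mY _ _ _ B mB; rewrite setTI; exact: mY. Qed.

(** The charge with density [Z], seen only on the sub-sigma-algebra; its density there is the
    conditional expectation. *)
Definition sub_charge Z (iZ : L1 Z) (A : set TG) : \bar R :=
  (\int[P]_(x in A) (Z x)%:E)%E.

Section sub_charge.
Variables (Z : T -> R) (iZ : L1 Z).

Let sub_charge0 : sub_charge iZ set0 = 0%E.
Proof. by rewrite /sub_charge integral_set0. Qed.

Let sub_charge_fin A : measurable A -> sub_charge iZ A \is a fin_num.
Proof. by move=> /subG mA; exact: (fin_num_measure (induced_charge iZ)). Qed.

Let sub_charge_sigma_additive : semi_sigma_additive (sub_charge iZ).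
Proof.
move=> F mF tF mUF; apply: (@charge_semi_sigma_additive _ _ _ (induced_charge iZ) F) => //.
- by move=> n; exact: subG (mF n).
- exact: subG.
Qed.

HB.instance Definition _ := isCharge.Build _ _ _ (sub_charge iZ)
  sub_charge0 sub_charge_fin sub_charge_sigma_additive.

End sub_charge.

(** As a map to the coarser measurable space, the identity pushes [P] forward to the restriction of
    [P] to the sub-sigma-algebra. *)
Definition sub_id (x : T) : TG := x.

Let measurable_sub_id : measurable_fun [set: T] sub_id.
Proof. by move=> _ B mB; rewrite setTI; exact: subG. Qed.

HB.instance Definition _ := isMeasurableFun.Build _ _ _ _ sub_id measurable_sub_id.

(** The witness is the Radon-Nikodym derivative of [sub_charge] with respect to the restriction of
    [P]; it is finite everywhere, so [fine] loses nothing. *)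
Lemma cond_exp_exists Z : L1 Z -> exists Y, is_cond_exp P <<s G >> Z Y.
Proof.
move=> iZ; pose mu := distribution P sub_id.
pose nu : {charge set TG -> \bar R} := sub_charge iZ.
have numu : nu `<< mu.
  apply/null_content_dominatesP => A mA muA.
  apply: null_set_integral => //; first exact: subG.
  by apply: measurable_funTS; exact: measurable_int iZ.
pose Y0 := Radon_Nikodym nu mu.
have Yfin x : Y0 x \is a fin_num by exact: Radon_Nikodym_fin_num.
have iY0 : mu.-integrable setT Y0 by exact: Radon_Nikodym_integrable.
have mY0 : measurable_fun [set: TG] Y0 by exact: measurable_int iY0.
have YE : Y0 = EFin \o (fine \o Y0).
  by apply/funext => x /=; rewrite fineK.
have iY : L1 (fine \o Y0).
  rewrite -YE; apply/integrableP; split.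
    by move=> _ B mB; apply: subG; exact: mY0.
  have /integrableP[_] := iY0.
  by rewrite ge0_integral_distribution//; exact: measurableT_comp.
exists (fine \o Y0); split => //.
- have mY : Gmeas (fine \o Y0) by apply/measurable_EFinP; rewrite -YE.
  by move=> B mB; rewrite -[X in <<s G >> X]setTI; exact: mY.
- move=> A GA.
  have := Radon_Nikodym_integral numu GA; rewrite /nu/= /sub_charge => ->.
  transitivity (\int[P]_(x in sub_id @^-1` A) (Y0 \o sub_id) x)%E.
    by apply: eq_integral => x _ /=; rewrite fineK.
  rewrite -integral_pushforward//.
  have iYs : P.-integrable setT (Y0 \o sub_id) by move: iY; rewrite -YE.
  exact: integrableS measurableT (subG GA) _ iYs.
Qed.

End conditional_expectation.

(** * Pulling out bounded factors and the conditional Jensen inequality *)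

Section conditional_jensen.
Context {R : realType} {d} {T : measurableType d} (P : probability T R).
Variable G : set (set T).
Hypothesis subG : <<s G >> `<=` measurable.
Implicit Types (f g h Y Z : T -> R).

Local Notation TG := (g_sigma_algebraType G).
Local Notation L1 f := (P.-integrable [set: T] (EFin \o f)).
Local Notation E f := (\int[P]_x f x).
Local Notation Gmeas f := (measurable_fun [set: TG] (f : TG -> R)).

Lemma cond_exp_indic Z Y A : L1 Z -> is_cond_exp P <<s G >> Z Y -> <<s G >> A ->
  E (fun x => \1_A x * Y x) = E (fun x => \1_A x * Z x).
Proof.
move=> iZ [_ iY YZ] GA; have mA := subG GA.
by have := YZ A GA; rewrite !integral_indic_mul// => -[].
Qed.

(* Peeling off the binary digits of h, each of which is a G-measurable
   indicator, doubles the remaining integral while it stays below E |D|. *)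
Lemma indic_orthogonal_mul_le D h n : L1 D ->
  (forall A, <<s G >> A -> E (fun x => \1_A x * D x) = 0) ->
  Gmeas h -> (forall x, 0 <= h x <= 1) ->
  2 ^+ n * `|E (fun x => h x * D x)| <= E (fun x => `|D x|).
Proof.
move=> iD D0; elim: n h => [|n IH] h mh h01.
  have mh' := sub_measurable_fun subG mh.
  have h1 x : `|h x| <= 1 by have /andP[h0 h1] := h01 x; rewrite ger0_norm.
  have iH := integrable_bounded_mul mh' h1 iD.
  rewrite expr0 mul1r; apply: le_trans (expect_norm_le iH) _.
  apply: expect_le; [exact: integrable_normr|exact: integrable_normr|].
  by move=> x; rewrite normrM ler_piMl.
pose A := [set x | 2^-1 <= h x].
have GA : <<s G >> A.
  have := mh measurableT _ (measurable_itv `[2^-1, +oo[ ).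
  rewrite setTI; congr (<<s G >> _).
  by apply/seteqP; split => x /=; rewrite in_itv/= andbT.
have mA : measurable A := subG GA.
have := IH (fun x => 2 * h x - \1_A x).
have -> : E (fun x => (2 * h x - \1_A x) * D x) = 2 * E (fun x => h x * D x).
  have h1 x : `|h x| <= 1 by have /andP[h0 h1] := h01 x; rewrite ger0_norm.
  have iH := integrable_bounded_mul (sub_measurable_fun subG mh) h1 iD.
  rewrite -expectZ// -[RHS]subr0 -(D0 _ GA) -expectB; last 2 first.
  - exact: integrable_scaler.
  - exact: integrable_indic_mul.
  by apply: eq_Rintegral => x _; rewrite mulrBl mulrA.
rewrite normrM ger0_norm// mulrA -exprSr; apply.
- apply: measurable_funB; first exact: measurable_funM.
  exact: (@measurable_indic _ TG).
- move=> x; have := h01 x; rewrite indicE.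
  have [/set_mem hA|hA] := boolP (x \in A).
    by have : 2^-1 <= h x by []; rewrite /=; lra.
  have : h x < 2^-1 by rewrite ltNge; apply: contra hA => hx; rewrite inE.
  by rewrite /=; lra.
Qed.

(** The difference D = Y - Z integrates to 0 on every event of the sub-sigma-algebra. For h with
    values in [0, 1], [indic_orthogonal_mul_le] bounds 2^n |E(h D)| by E|D| for every n, so E(h D) =
    0; an affine rescaling reaches all bounded h. *)
Lemma cond_exp_mul Z Y h (M : R) : L1 Z -> is_cond_exp P <<s G >> Z Y ->
  Gmeas h -> (forall x, `|h x| <= M) ->
  E (fun x => h x * Y x) = E (fun x => h x * Z x).
Proof.
move=> iZ YZ mh hM; have [_ iY _] := YZ.
pose D x := Y x - Z x.
have iD : L1 D by exact: integrable_subr.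
have D0 A : <<s G >> A -> E (fun x => \1_A x * D x) = 0.
  move=> GA; have mA := subG GA.
  under eq_Rintegral do rewrite mulrBr.
  rewrite expectB; [|exact: integrable_indic_mul..].
  by rewrite (cond_exp_indic iZ YZ GA) subrr.
have hD0 g : Gmeas g -> (forall x, 0 <= g x <= 1) -> E (fun x => g x * D x) = 0.
  move=> mg g01; apply/eqP; rewrite -normr_eq0; apply/eqP/le_anti.
  rewrite normr_ge0 andbT leNgt; apply/negP => c0.
  set c := `|_| in c0; set K := E (fun x => `|D x|).
  have H n : 2 ^+ n * c <= K by exact: indic_orthogonal_mul_le.
  have K0 : 0 <= K by exact: expect_ge0.
  have := archi_boundP (divr_ge0 K0 (ltW c0)); rewrite ltr_pdivrMr// ltNge => /negP; apply.
  apply: le_trans (H (Num.bound (K / c))); rewrite ler_pM2r//.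
  by rewrite -natrX ler_nat ltnW// ltn_expl.
have M0 : 0 < `|M| + 1 by rewrite ltr_wpDl.
set M1 := `|M| + 1 in M0.
have hM1 x : `|h x| <= M1 by rewrite (le_trans (hM x))// (le_trans (ler_norm _))// lerDl.
have mh' := sub_measurable_fun subG mh.
have DE : E D = 0.
  have := D0 setT (@measurableT _ TG).
  by under eq_Rintegral do rewrite indicT mul1r.
have H : E (fun x => h x * D x) = 0.
  have mg : Gmeas (fun x => (h x + M1) / (2 * M1)).
    by apply: measurable_funM => //; exact: measurable_funD.
  have g01 x : 0 <= (h x + M1) / (2 * M1) <= 1.
    have := hM1 x; rewrite ler_norml => /andP[h1 h2].
    by rewrite divr_ge0 ?ler_pdivrMr//=; lra.
  have := hD0 _ mg g01.
  have -> : E (fun x => (h x + M1) / (2 * M1) * D x) =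
      (2 * M1)^-1 * (E (fun x => h x * D x) + M1 * E D).
    rewrite -(expectZ M1 iD) -expectD; last 2 first.
    - exact: integrable_bounded_mul hM1 iD.
    - exact: integrable_scaler.
    rewrite -expectZ; last first.
      by apply: integrable_addr; [exact: integrable_bounded_mul hM1 iD|exact: integrable_scaler].
    by apply: eq_Rintegral => x _; rewrite -mulrDl mulrA; congr (_ * _); rewrite mulrC.
  rewrite DE mulr0 addr0 => /eqP; rewrite mulf_eq0 invr_eq0 => /orP[|/eqP//].
  by rewrite mulf_eq0 pnatr_eq0/= gt_eqF.
apply/eqP; rewrite -subr_eq0 -expectB; [|exact: integrable_bounded_mul hM1 _..].
by under eq_Rintegral do rewrite -mulrBr; rewrite H.
Qed.

(** On the event |Y| <= N, psi(Y) is bounded and measurable for the sub-sigma-algebra, hence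
    orthogonal to Z - Y; integrating the tangent inequality at Y leaves E[phi(Y); |Y| <= N] <= E
    phi(Z). Monotone convergence in N gives integrability and the bound together. The subgradient is
    explicit so that its measurability and local boundedness are at hand. *)
Lemma cond_exp_jensen (phi psi : R -> R) Z Y :
  measurable_fun [set: R] phi -> measurable_fun [set: R] psi ->
  (forall x, 0 <= phi x) ->
  (forall x y, phi x + psi x * (y - x) <= phi y) ->
  (forall N, exists C, forall x, `|x| <= N -> `|psi x| <= C) ->
  L1 Z -> is_cond_exp P <<s G >> Z Y -> L1 (phi \o Z) ->
  L1 (phi \o Y) /\ E (phi \o Y) <= E (phi \o Z).
Proof.
move=> mphi mpsi phi0 tangent psib iZ YZ iphiZ; have [_ iY _] := YZ.
have mY := cond_exp_measurable YZ.
have mY' := integrable_measurable iY.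
pose B (N : nat) := [set x | `|Y x| <= N%:R].
have GB N : <<s G >> (B N).
  have := mY measurableT _ (measurable_itv `[- N%:R, N%:R]).
  rewrite setTI; congr (<<s G >> _).
  by apply/seteqP; split => x; rewrite /B/= in_itv/= ler_norml.
have mB N : measurable (B N) := subG (GB N).
have mphiY : measurable_fun [set: T] (phi \o Y) by exact: measurableT_comp.
have main N : L1 (fun x => \1_(B N) x * phi (Y x)) /\
    E (fun x => \1_(B N) x * phi (Y x)) <= E (phi \o Z).
  have [C HC] := psib N%:R.
  have mh : Gmeas (fun x => \1_(B N) x * psi (Y x)).
    apply: measurable_funM; first by apply: (@measurable_indic _ TG); exact: GB.
    exact: (@measurableT_comp _ _ _ TG _ _ psi _ Y).
  have C0 : 0 <= C by rewrite (le_trans _ (HC 0 _)) ?normr0.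
  have hC x : `|\1_(B N) x * psi (Y x)| <= C.
    rewrite indicE; have [|_] := boolP (x \in B N); last by rewrite mul0r normr0.
    by rewrite inE mul1r => /HC.
  have mh' := sub_measurable_fun subG mh.
  have EhD : E (fun x => \1_(B N) x * psi (Y x) * (Z x - Y x)) = 0.
    under eq_Rintegral do rewrite mulrBr.
    rewrite expectB; [|exact: integrable_bounded_mul hC _..].
    by rewrite (cond_exp_mul iZ YZ mh hC) subrr.
  have iB : L1 (fun x => \1_(B N) x * phi (Y x)).
    apply: (@integrable_bounded _ _ _ _ _ (phi 0 + C * N%:R)).
      by apply: measurable_funM => //; exact: measurable_indic.
    move=> x; rewrite indicE; have [|_] := boolP (x \in B N); last first.
      by rewrite mul0r normr0 addr_ge0 ?mulr_ge0.
    rewrite inE mul1r => Bx; rewrite ger0_norm//.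
    (* The tangent at Y(x), read at 0, bounds phi(Y) by phi(0) + psi(Y) Y, which is bounded on
       [B N]. *)
    have := tangent (Y x) 0; rewrite sub0r mulrN lerBlDr => /le_trans; apply.
    rewrite lerD2l (le_trans (ler_norm _))// normrM ler_pM//.
    exact: HC.
  split=> //; rewrite -[leLHS]addr0 -EhD -expectD//; last first.
    by apply: integrable_bounded_mul hC _ => //; exact: integrable_subr.
  apply: expect_le => //.
    apply: integrable_addr => //.
    by apply: integrable_bounded_mul hC _ => //; exact: integrable_subr.
  move=> x; rewrite -mulrA -mulrDr indicE; case: (x \in _).
    by rewrite mul1r.
  by rewrite mul0r; exact: phi0.
have ub : (\int[P]_x ((phi \o Y) x)%:E <= (E (phi \o Z))%:E)%E.
  have BT : \bigcup_N B N = setT.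
    apply/seteqP; split => // x _.
    exists (Num.bound `|Y x|) => //=; apply/ltW/archi_boundP; exact: normr_ge0.
  have ndB : nondecreasing_seq B.
    move=> m n mn; rewrite subsetEset => x /le_trans; apply.
    by rewrite ler_nat.
  have cv : (\int[P]_(x in B N) (EFin \o (phi \o Y)) x)%E @[N --> \oo] -->
      (\int[P]_(x in \bigcup_N B N) (EFin \o (phi \o Y)) x)%E.
    apply: ge0_nondecreasing_set_cvg_integral => //.
    - by move=> N; apply: measurable_funTS; exact/measurable_EFinP.
    - by move=> N x _; rewrite lee_fin; exact: phi0.
  rewrite BT in cv; rewrite -(cvg_lim _ cv)//.
  apply: lime_le; first by apply/cvg_ex; eexists; exact: cv.
  apply: nearW => N; have [iB leB] := main N.
  rewrite integral_mkcond (_ : \int[P]_x _ = (E (fun x => \1_(B N) x * phi (Y x)))%:E)%E ?lee_fin//.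
  rewrite -expect_EFin//; apply: eq_integral => x _.
  by rewrite patchE indicE; case: (x \in _); rewrite ?mul1r ?mul0r.
have iphiY : L1 (phi \o Y).
  apply/integrableP; split; first exact/measurable_EFinP.
  under eq_integral do rewrite /= ger0_norm//.
  by apply: le_lt_trans ub _; rewrite ltry.
split=> //; rewrite -lee_fin -expect_EFin//.
Qed.

End conditional_jensen.

(** * Moments and uniform convexity *)

Section moments.
Context {R : realType} {d} {T : measurableType d} (P : probability T R).
Implicit Types (f g : T -> R) (p r : R).

Local Notation L1 f := (P.-integrable [set: T] (EFin \o f)).
Local Notation E f := (\int[P]_x f x).

(** The p-th power of the L_p norm as a real number: a norm bound c is stated as a moment bound c^p,
    without roots or infinite values. *)
Definition moment p f : R := E (fun x => `|f x| `^ p).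

Definition finite_moment p f :=
  measurable_fun [set: T] f /\ L1 (fun x => `|f x| `^ p).

Lemma moment_ge0 p f : 0 <= moment p f.
Proof. by apply: expect_ge0 => x; exact: powR_ge0. Qed.

Lemma measurable_normr_powR p f : measurable_fun [set: T] f ->
  measurable_fun [set: T] (fun x => `|f x| `^ p).
Proof.
move=> mf; apply: (measurableT_comp (measurable_powR _)) => //.
exact: measurableT_comp.
Qed.

Lemma finite_moment_dominated p f g : measurable_fun [set: T] f ->
  L1 g -> (forall x, `|f x| `^ p <= g x) -> finite_moment p f.
Proof.
move=> mf ig fg; split=> //; apply: (integrable_dominated _ _ ig).
  exact: measurable_normr_powR.
by move=> x; rewrite ger0_norm ?powR_ge0.
Qed.

Lemma finite_momentZ p (a : R) f : finite_moment p f -> finite_moment p (fun x => a * f x).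
Proof.
move=> [mf iF]; apply: (finite_moment_dominated _ (integrable_scaler (`|a| `^ p) iF)).
  exact: measurable_funM.
by move=> x; rewrite normrM powRM.
Qed.

Lemma momentZ p (a : R) f : finite_moment p f ->
  moment p (fun x => a * f x) = `|a| `^ p * moment p f.
Proof.
move=> [_ iF]; rewrite /moment -expectZ//.
by apply: eq_Rintegral => x _; rewrite normrM powRM.
Qed.

Lemma finite_momentD p f g : 0 <= p -> finite_moment p f -> finite_moment p g ->
  finite_moment p (fun x => f x + g x).
Proof.
move=> p0 [mf iF] [mg iG].
apply: (finite_moment_dominated _ (integrable_scaler (2 `^ p) (integrable_addr iF iG))).
  exact: measurable_funD.
move=> x; have [fg|/ltW gf] := leP `|f x| `|g x|.
- apply: (@le_trans _ _ ((2 * `|g x|) `^ p)).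
    by rewrite ge0_ler_powR ?nnegrE ?mulr_ge0// (le_trans (ler_normD _ _))//; lra.
  by rewrite powRM// ler_wpM2l ?powR_ge0// lerDr powR_ge0.
- apply: (@le_trans _ _ ((2 * `|f x|) `^ p)).
    by rewrite ge0_ler_powR ?nnegrE ?mulr_ge0// (le_trans (ler_normD _ _))//; lra.
  by rewrite powRM// ler_wpM2l ?powR_ge0// lerDl powR_ge0.
Qed.

Lemma finite_momentB p f g : 0 <= p -> finite_moment p f -> finite_moment p g ->
  finite_moment p (fun x => f x - g x).
Proof.
move=> p0 fp gp; have := finite_momentD p0 fp (finite_momentZ (-1) gp).
by under eq_fun do rewrite mulN1r.
Qed.

Lemma finite_moment_cst p (a : R) : finite_moment p (fun=> a).
Proof. by split=> //; exact: integrable_const. Qed.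

Lemma finite_moment_le r p f : 0 <= r <= p -> finite_moment p f -> finite_moment r f.
Proof.
move=> /andP[r0 rp] [mf iF].
apply: (finite_moment_dominated _ (integrable_addr (integrable_const P 1) iF)) => //.
move=> x; have [f1|/ltW f1] := leP `|f x| 1.
  rewrite (@le_trans _ _ (1 `^ r)) ?powR1 ?lerDl ?powR_ge0//.
  by have := @ge0_ler_powR _ r r0 `|f x| 1; rewrite !nnegrE powR1; apply.
by rewrite (@le_trans _ _ (`|f x| `^ p)) ?lerDr// ler_powR.
Qed.

Lemma finite_moment1 f : finite_moment 1 f <-> L1 f.
Proof.
split=> [[mf iF]|iF].
  by apply: (integrable_dominated mf _ iF) => x; rewrite powRr1.
split; first exact: integrable_measurable iF.
by under eq_fun do rewrite powRr1//; exact: integrable_normr.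
Qed.

Lemma finite_moment_integrable p f : 1 <= p -> finite_moment p f -> L1 f.
Proof. by move=> p1 fp; apply/finite_moment1; apply: finite_moment_le fp; rewrite ler01. Qed.

(** The tangent of t^(p/r) at 1 is read at t = (|f| / c)^r and integrated; this is the monotonicity
    of L_p norms on a probability space. For c = 0, where the quotient fails, a positive bound is
    let tend to 0. *)
Lemma moment_le_powR r p f (c : R) : 0 < r <= p -> 0 <= c -> finite_moment p f ->
  moment p f <= c `^ p -> moment r f <= c `^ r.
Proof.
move=> /andP[r0 rp] c0 fp fc.
have p0 : 0 < p by lra.
have [_ ifr] : finite_moment r f by apply: finite_moment_le fp; rewrite (ltW r0).
have [_ ifp] := fp.
have pos e : 0 < e -> moment p f <= e `^ p -> moment r f <= e `^ r.
  move=> e0 fe.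
  have ep : 0 < e `^ p by rewrite powR_gt0.
  have er : 0 < e `^ r by rewrite powR_gt0.
  have pw x : `|f x| `^ r <= e `^ r * (1 - r / p) + e `^ r * (r / p / e `^ p) * `|f x| `^ p.
    have := @powR_tangent _ (p / r) 1 ((`|f x| / e) `^ r).
    rewrite ler_pdivlMr// mul1r rp ler01 powR_ge0 !powR1 => /(_ isT isT isT).
    rewrite -powRrM (mulrC r) divfK ?gt_eqF// mulr1.
    have pd a : (`|f x| / e) `^ a = `|f x| `^ a / e `^ a.
      apply: (mulIf (lt0r_neq0 (powR_gt0 a e0))).
      by rewrite -powRM ?divr_ge0 ?(ltW e0)// !divfK ?gt_eqF ?powR_gt0.
    rewrite !pd; set u := `|f x| `^ r; set v := `|f x| `^ p => H.
    have : u / e `^ r <= 1 - r / p + r / p * (v / e `^ p).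
      have rp0 : 0 < r / p by rewrite divr_gt0.
      rewrite -(ler_pM2l rp0) mulrDr mulrA mulr1 in H.
      have E1 : r / p * (p / r) = 1 by field; rewrite !gt_eqF.
      by move: H; rewrite E1; lra.
    rewrite -(ler_pM2l er) mulrCA divff ?gt_eqF// mulr1 => /le_trans; apply.
    by rewrite le_eqVlt; apply/orP; left; apply/eqP; ring.
  apply: (le_trans (expect_le ifr _ pw)).
    by apply: integrable_addr; [exact: integrable_const|exact: integrable_scaler].
  rewrite expectD; [|exact: integrable_const|exact: integrable_scaler].
  rewrite expect_cst expectZ// -/(moment p f) -mulrA -mulrDr ler_piMr// ?(ltW er)//.
  have : moment p f / e `^ p <= 1 by rewrite ler_pdivrMr// mul1r.
  have rp0 : 0 < r / p by rewrite divr_gt0.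
  rewrite -(ler_pM2l rp0) mulr1 mulrA => H.
  by rewrite -mulrA (mulrC _^-1) mulrA; lra.
move: c0; rewrite le_eqVlt => /predU1P[c0|c0]; last exact: pos.
rewrite -c0 powR0 ?gt_eqF// in fc; rewrite -c0 powR0 ?gt_eqF//.
apply/ler_addgt0Pr => e e0; rewrite add0r.
rewrite -(powR_invK r0 (ltW e0)); apply: pos; first by rewrite powR_gt0.
exact: le_trans fc (powR_ge0 _ _).
Qed.

End moments.

Section moment_convexity.
Context {R : realType} {d} {T : measurableType d} (P : probability T R).
Implicit Types (f g u v : T -> R) (p q : R).

Local Notation L1 f := (P.-integrable [set: T] (EFin \o f)).
Local Notation E f := (\int[P]_x f x).

(** Integrating [powR_superadditive] gives the bound for positive [A] and [B]. Its weights
    degenerate when one of them is 0, where monotonicity suffices. *)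
Lemma reverse_minkowski q u v (A B : R) : 0 < q <= 1 -> 0 <= A -> 0 <= B ->
  (forall x, 0 <= u x) -> (forall x, 0 <= v x) ->
  L1 (fun x => u x `^ q) -> L1 (fun x => v x `^ q) ->
  L1 (fun x => (u x + v x) `^ q) ->
  E (fun x => u x `^ q) = A `^ q -> E (fun x => v x `^ q) = B `^ q ->
  (A + B) `^ q <= E (fun x => (u x + v x) `^ q).
Proof.
move=> q01 A0 B0 u0 v0 iu iv iuv EA EB; have /andP[q0 q1] := q01.
move: A0; rewrite le_eqVlt => /predU1P[A0|A0].
  rewrite -A0 add0r -EB; apply: expect_le => // x.
  by rewrite ge0_ler_powR ?nnegrE ?addr_ge0 ?lerDr// ltW.
move: B0; rewrite le_eqVlt => /predU1P[B0|B0].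
  rewrite -B0 addr0 -EA; apply: expect_le => // x.
  by rewrite ge0_ler_powR ?nnegrE ?addr_ge0 ?lerDl// ltW.
pose a := (A + B) `^ q * (A / (A + B) / A `^ q).
pose b := (A + B) `^ q * (B / (A + B) / B `^ q).
have -> : (A + B) `^ q = E (fun x => a * u x `^ q + b * v x `^ q).
  rewrite expectD ?expectZ//; [|exact: integrable_scaler..].
  rewrite EA EB /a /b -!mulrA !(mulVf (lt0r_neq0 (powR_gt0 _ _)))// !mulr1.
  by rewrite -mulrDr -mulrDl divff ?mulr1// gt_eqF// addr_gt0.
apply: expect_le => //; first by apply: integrable_addr; exact: integrable_scaler.
move=> x; apply: le_trans (powR_superadditive q01 A0 B0 (u0 x) (v0 x)).
by rewrite le_eqVlt; apply/orP; left; apply/eqP; rewrite /a /b; ring.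
Qed.

(** The squared L_p norm, in which the convexity of L_p for p <= 2 is quadratic. *)
Definition sqnorm p f : R := moment P p f `^ (2 / p).

Lemma sqnorm_ge0 p f : 0 <= sqnorm p f.
Proof. exact: powR_ge0. Qed.

Lemma sqnormZ p (a : R) f : 0 < p -> finite_moment P p f ->
  sqnorm p (fun x => a * f x) = a ^+ 2 * sqnorm p f.
Proof.
move=> p0 fp; rewrite /sqnorm momentZ// powRM ?powR_ge0 ?moment_ge0//.
rewrite -powRrM mulrCA divff ?gt_eqF// mulr1 powR_mulrn//.
by rewrite real_normK// num_real.
Qed.

Lemma sqnorm_powR p f : 0 < p -> sqnorm p f `^ (p / 2) = moment P p f.
Proof.
move=> p0; rewrite -powRrM (_ : 2 / p * (p / 2) = 1) ?powRr1 ?moment_ge0//.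
by field; rewrite gt_eqF.
Qed.

(** The pointwise two-point inequality is integrated. With q = p / 2, reverse Minkowski in L_q for
    f^2 and (p - 1) g^2 extracts the norms on the left, concavity of t^q gathers those on the right,
    and the power q is removed by strict monotonicity. *)
Lemma sqnorm_two_point p f g : 1 < p <= 2 -> finite_moment P p f -> finite_moment P p g ->
  2 * (sqnorm p f + (p - 1) * sqnorm p g) <=
    sqnorm p (fun x => f x + g x) + sqnorm p (fun x => f x - g x).
Proof.
move=> p12 fp gp; have /andP[p1 p2] := p12; have p0 : 0 < p by lra.
have p10 : 0 <= p - 1 by lra.
have q01 : 0 < p / 2 <= 1 by lra.
have pq0 : 0 < p / 2 by lra.
have [mf iF] := fp; have [mg iG] := gp.
have [mfg ifg] := finite_momentD (ltW p0) fp gp.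
have [mfg' ifg'] := finite_momentB (ltW p0) fp gp.
set S1 := sqnorm p (fun x => f x + g x); set S2 := sqnorm p (fun x => f x - g x).
have E1 : S1 `^ (p / 2) = E (fun x => `|f x + g x| `^ p) by exact: sqnorm_powR.
have E2 : S2 `^ (p / 2) = E (fun x => `|f x - g x| `^ p) by exact: sqnorm_powR.
have S10 : 0 <= S1 by exact: sqnorm_ge0.
have S20 : 0 <= S2 by exact: sqnorm_ge0.
clearbody S1 S2.
have sq (t : R) : (t ^+ 2) `^ (p / 2) = `|t| `^ p.
  by rewrite -[t ^+ 2]real_normK ?num_real// -powR_mulrn// -powRrM; congr (_ `^ _); field.
have pg (t : R) : ((p - 1) * t ^+ 2) `^ (p / 2) = (p - 1) `^ (p / 2) * `|t| `^ p.
  by rewrite powRM ?sqr_ge0 ?sq.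
have mq : measurable_fun [set: T] (fun x => (f x ^+ 2 + (p - 1) * g x ^+ 2) `^ (p / 2)).
  apply: (measurableT_comp (measurable_powR _)) => //.
  apply: measurable_funD; first exact: measurable_funX.
  by apply: measurable_funM => //; exact: measurable_funX.
have iS := integrable_addr ifg ifg'.
have iq : L1 (fun x => (f x ^+ 2 + (p - 1) * g x ^+ 2) `^ (p / 2)).
  apply: (integrable_dominated mq _ iS) => x; rewrite ger0_norm ?powR_ge0//.
  apply: le_trans (powR_two_point (f x) (g x) p12).
  by rewrite ler_peMl ?powR_ge0 ?ler1n.
have H1 : (sqnorm p f + (p - 1) * sqnorm p g) `^ (p / 2) <=
    E (fun x => (f x ^+ 2 + (p - 1) * g x ^+ 2) `^ (p / 2)).
  apply: (@reverse_minkowski (p / 2) (fun x => f x ^+ 2) (fun x => (p - 1) * g x ^+ 2) _ _ q01).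
  - exact: sqnorm_ge0.
  - by rewrite mulr_ge0 ?sqnorm_ge0.
  - by move=> x; exact: sqr_ge0.
  - by move=> x; rewrite mulr_ge0 ?sqr_ge0.
  - by under eq_fun do rewrite sq.
  - by under eq_fun do rewrite pg; exact: integrable_scaler.
  - exact: iq.
  - by under eq_Rintegral do rewrite sq; exact/esym/sqnorm_powR.
  - under eq_Rintegral do rewrite pg; rewrite expectZ//.
    by rewrite powRM ?sqnorm_ge0 ?sqnorm_powR.
have H2 : 2 * E (fun x => (f x ^+ 2 + (p - 1) * g x ^+ 2) `^ (p / 2)) <=
    S1 `^ (p / 2) + S2 `^ (p / 2).
  have E3 := expectD ifg ifg'; have E4 := expectZ 2 iq.
  apply: (@le_trans _ _ (E (fun x => 2 * (f x ^+ 2 + (p - 1) * g x ^+ 2) `^ (p / 2)))).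
    by rewrite E4.
  apply: (@le_trans _ _ (E (fun x => `|f x + g x| `^ p + `|f x - g x| `^ p))).
    by apply: expect_le => //; [exact: integrable_scaler|move=> x; exact: powR_two_point].
  by rewrite E3 E1 E2.
have F0 : 0 <= sqnorm p f + (p - 1) * sqnorm p g.
  by rewrite addr_ge0 ?mulr_ge0 ?sqnorm_ge0.
set e := Rintegral _ _ _ in H1 H2; set F := sqnorm p f + _ in H1 F0 *.
clearbody e F.
clear -q01 pq0 S10 S20 H1 H2 F0.
have H3 : 2^-1 * S1 `^ (p / 2) + (1 - 2^-1) * S2 `^ (p / 2) <=
    (2^-1 * S1 + (1 - 2^-1) * S2) `^ (p / 2).
  by apply: powR_concave => //; lra.
have H4 : F `^ (p / 2) <= (2^-1 * S1 + (1 - 2^-1) * S2) `^ (p / 2) by lra.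
suff : F <= 2^-1 * S1 + (1 - 2^-1) * S2 by lra.
rewrite leNgt; apply/negP => H5; move: H4; rewrite leNgt => /negP; apply.
by rewrite gt0_ltr_powR ?nnegrE//; lra.
Qed.

End moment_convexity.

(** * Contraction and uniform convexity for conditional expectations *)

Section conditional_moments.
Context {R : realType} {d} {T : measurableType d} (P : probability T R).
Variable G : set (set T).
Hypothesis subG : <<s G >> `<=` measurable.
Implicit Types (f g h Y Z : T -> R) (p r : R).

Local Notation TG := (g_sigma_algebraType G).
Local Notation L1 f := (P.-integrable [set: T] (EFin \o f)).
Local Notation E f := (\int[P]_x f x).
Local Notation Gmeas f := (measurable_fun [set: TG] (f : TG -> R)).

Lemma cond_expP Z Y : L1 Z ->
  is_cond_exp P <<s G >> Z Y <->
  [/\ Gmeas Y, L1 Y & forall A, <<s G >> A ->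
    E (fun x => \1_A x * Y x) = E (fun x => \1_A x * Z x)].
Proof.
move=> iZ; split=> [YZ|[mY iY YZ]].
  split; [exact: cond_exp_measurable YZ|by case: YZ|].
  by move=> A; exact: cond_exp_indic.
split=> // [B mB|A GA].
  by rewrite -[X in <<s G >> X]setTI; exact: mY.
have mA := subG GA.
by rewrite !integral_indic_mul// YZ.
Qed.

Lemma cond_expB Z1 Z2 Y1 Y2 : L1 Z1 -> L1 Z2 ->
  is_cond_exp P <<s G >> Z1 Y1 -> is_cond_exp P <<s G >> Z2 Y2 ->
  is_cond_exp P <<s G >> (fun x => Z1 x - Z2 x) (fun x => Y1 x - Y2 x).
Proof.
move=> iZ1 iZ2 /(cond_expP _ iZ1)[m1 i1 H1] /(cond_expP _ iZ2)[m2 i2 H2].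
apply/cond_expP; first exact: integrable_subr.
split; [exact: measurable_funB|exact: integrable_subr|move=> A GA].
have mA := subG GA.
under eq_Rintegral do rewrite mulrBr.
under [RHS]eq_Rintegral do rewrite mulrBr.
by rewrite !expectB ?H1 ?H2//; exact: integrable_indic_mul.
Qed.

Lemma cond_exp_cst (a : R) : is_cond_exp P <<s G >> (fun=> a) (fun=> a).
Proof.
apply/cond_expP; first exact: integrable_const.
by split=> //; exact: integrable_const.
Qed.

Lemma cond_exp_expect Z Y : L1 Z -> is_cond_exp P <<s G >> Z Y -> E Y = E Z.
Proof.
move=> iZ YZ; have := cond_exp_indic subG iZ YZ (@measurableT _ TG).
by under eq_Rintegral do rewrite indicT mul1r; under [in RHS]eq_Rintegral do rewrite indicT mul1r.
Qed.

(** Jensen for |x|^p, with the subgradient of [powR_normr_tangent]. *)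
Lemma cond_exp_moment p Z Y : 1 <= p -> finite_moment P p Z ->
  is_cond_exp P <<s G >> Z Y ->
  finite_moment P p Y /\ moment P p Y <= moment P p Z.
Proof.
move=> p1 Zp YZ; have iZ := finite_moment_integrable p1 Zp.
have [_ iZp] := Zp; have [_ iY _] := YZ.
have mphi : measurable_fun [set: R] (fun x : R => `|x| `^ p).
  exact: (@measurableT_comp _ _ _ _ _ _ (fun z : R => z `^ p) _ (@Num.norm R R)).
(* The sign is written with indicators to obtain its measurability. *)
have sgE : (@Num.sg R) = (fun x => \1_(`]0, +oo[%classic) x - \1_(`]-oo, 0[%classic) x).
  apply/funext => x; rewrite !indicE.
  have [x0|x0|->] := ltgtP x 0.
  - by rewrite ltr0_sg// memNset ?mem_set/= ?in_itv//= ?sub0r// andbT ltNge ltW.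
  - by rewrite gtr0_sg// mem_set ?memNset/= ?in_itv//= ?subr0 ?andbT// ltNge ltW.
  - by rewrite sgr0 !memNset/= ?in_itv/= ?ltxx// subrr.
have mpsi : measurable_fun [set: R] (fun x : R => p * Num.sg x * `|x| `^ (p - 1)).
  apply: measurable_funM.
    apply: measurable_funM => //; rewrite sgE.
    by apply: measurable_funB; exact: measurable_indic.
  exact: (@measurableT_comp _ _ _ _ _ _ (fun z : R => z `^ (p - 1)) _ (@Num.norm R R)).
have [] := @cond_exp_jensen _ _ _ P G subG (fun x => `|x| `^ p)
  (fun x => p * Num.sg x * `|x| `^ (p - 1)) Z Y mphi mpsi _ _ _ iZ YZ iZp.
- by move=> x; exact: powR_ge0.
- by move=> x y; exact: powR_normr_tangent.
- move=> N; exists (p * N `^ (p - 1)) => x xN.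
  have p0 : 0 <= p by rewrite (le_trans ler01).
  rewrite 2!normrM (ger0_norm p0) (ger0_norm (powR_ge0 _ _)) -mulrA ler_wpM2l//.
  rewrite -[leRHS]mul1r ler_pM ?powR_ge0//.
    by rewrite normr_sg lern1 leq_b1.
  by rewrite ge0_ler_powR ?nnegrE ?subr_ge0// (le_trans _ xN).
- by move=> iYp le_Yp; split=> //; split=> //; exact: integrable_measurable iY.
Qed.

(* sqnorm (Y + t D) is minimal at t = 0 by contraction, and the two-point
   inequality bounds its second differences below by 2 (p - 1) t^2 sqnorm D:
   sum these along t = 1, 1/2, 1/4, ... *)
Lemma cond_exp_sqnorm p Z Y : 1 < p <= 2 -> finite_moment P p Z ->
  is_cond_exp P <<s G >> Z Y ->
  sqnorm P p Y + (p - 1) * sqnorm P p (fun x => Z x - Y x) <= sqnorm P p Z.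
Proof.
move=> p12 Zp YZ; have /andP[p1 p2] := p12.
have p0 : 0 <= p by rewrite (le_trans ler01)// ltW.
have p0' : 0 < p by rewrite (lt_trans ltr01).
have [Yp _] := cond_exp_moment (ltW p1) Zp YZ.
have Dp := finite_momentB p0 Zp Yp.
set D := (fun x => Z x - Y x) in Dp *.
have iZ := finite_moment_integrable (ltW p1) Zp.
have iY := finite_moment_integrable (ltW p1) Yp.
have iD := finite_moment_integrable (ltW p1) Dp.
pose u t := sqnorm P p (fun x => Y x + t * D x) - sqnorm P p Y.
have tDp t : finite_moment P p (fun x => t * D x) by exact: finite_momentZ.
have YDp t : finite_moment P p (fun x => Y x + t * D x) by exact: finite_momentD.
have u0 t : 0 <= u t.
  have ce : is_cond_exp P <<s G >> (fun x => Y x + t * D x) Y.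
    have /(cond_expP _ iZ)[mY _ H] := YZ.
    apply/cond_expP; first by apply: finite_moment_integrable (YDp t); exact: ltW.
    split=> // A GA; have mA := subG GA.
    have DA : E (fun x => \1_A x * D x) = 0.
      under eq_Rintegral do rewrite mulrBr.
      by rewrite expectB ?H ?subrr//; exact: integrable_indic_mul.
    rewrite -[LHS]addr0 -(mulr0 t) -DA -expectZ ?integrable_indic_mul//.
    rewrite -expectD; last 2 first.
    - exact: integrable_indic_mul.
    - by apply: integrable_scaler; exact: integrable_indic_mul.
    by apply: eq_Rintegral => x _; rewrite [in RHS]mulrDr (mulrCA t).
  have [_ leY] := cond_exp_moment (ltW p1) (YDp t) ce.
  by rewrite subr_ge0 ge0_ler_powR ?nnegrE ?moment_ge0// divr_ge0.
(* The two-point inequality at Y + (t / 2) D and (t / 2) D, whose sum is Y + t D and whose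
   difference is Y. *)
have step t : 2 * u (t / 2) + (p - 1) * (t ^+ 2 / 2) * sqnorm P p D <= u t.
  have := sqnorm_two_point p12 (YDp (t / 2)) (tDp (t / 2)).
  rewrite sqnormZ//.
  have -> : (fun x => Y x + t / 2 * D x + t / 2 * D x) = (fun x => Y x + t * D x).
    by apply/funext => x; field.
  have -> : (fun x => Y x + t / 2 * D x - t / 2 * D x) = Y.
    by apply/funext => x; rewrite addrK.
  rewrite /u; move: (sqnorm _ _ _) (sqnorm _ _ _) (sqnorm _ _ _) (sqnorm _ _ _) => a b c e.
  clear; rewrite mulrDr => H; rewrite -subr_ge0.
  rewrite -subr_ge0 in H; apply: le_trans H _; rewrite le_eqVlt; apply/orP; left; apply/eqP.
  by field.
have u1 : u 1 = sqnorm P p Z - sqnorm P p Y.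
  have -> // : Z = fun x => Y x + 1 * D x.
  by apply/funext => x; rewrite mul1r subrKC.
(* Scaled by 2^n, the step at t = 2^-n contributes (p - 1) |D|^2 times 2^-(n + 1), and these factors
   add up to 1 - 2^-n. *)
have iter n : (p - 1) * sqnorm P p D * (1 - (2 ^- n)) + 2 ^+ n * u (2 ^- n) <= u 1.
  elim: n => [|n]; first by rewrite expr0 invr1 subrr mulr0 mul1r add0r.
  apply: le_trans; have := step (2 ^- n).
  have e0 : 0 < 2 ^+ n :> R by rewrite exprn_gt0.
  have -> : 2 ^- n / 2 = 2 ^- n.+1 :> R by rewrite exprSr invfM.
  rewrite -(ler_pM2l e0) => H.
  move: (u _) (u _) (sqnorm _ _ _) H => a b c H.
  rewrite exprSr invfM; move: (2 ^+ n) e0 H => e e0 H.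
  rewrite -subr_ge0 in H; rewrite -subr_ge0; apply: le_trans H _.
  rewrite le_eqVlt; apply/orP; left; apply/eqP; field.
  by rewrite gt_eqF.
have lim n : (p - 1) * sqnorm P p D * (1 - (2 ^- n)) <= sqnorm P p Z - sqnorm P p Y.
  rewrite -u1; apply: le_trans (iter n).
  by rewrite lerDl mulr_ge0// exprn_ge0.
set c := (p - 1) * sqnorm P p D in lim *.
set s := _ - _ in lim.
rewrite addrC -lerBrDr -/s leNgt; apply/negP => sc.
have c0 : 0 <= c by rewrite mulr_ge0 ?sqnorm_ge0 ?subr_ge0 ?ltW.
clearbody c s; clear -lim sc c0.
have cs : 0 < c - s by rewrite subr_gt0.
(* If s < c, some n exceeds c / (c - s); then 2^n >= n contradicts [lim n], which says 2^n (c - s)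
   <= c. *)
have := archi_boundP (divr_ge0 c0 (ltW cs)); rewrite ltr_pdivrMr// ltNge => /negP; apply.
set n := Num.bound _.
have e0 : 0 < 2 ^+ n :> R by rewrite exprn_gt0.
apply: (@le_trans _ _ (2 ^+ n * (c - s))).
  by rewrite ler_pM2r// -natrX ler_nat ltnW// ltn_expl.
rewrite -ler_pdivlMl//.
have := lim n; rewrite mulrBr mulr1 (mulrC c); lra.
Qed.

End conditional_moments.

(** * Mixing *)

Section Lnorm_moment.
Context {R : realType} {d} {T : measurableType d} (P : probability T R).
Implicit Types (f g : T -> R) (r : R).

Lemma Lnorm_moment r f : finite_moment P r f ->
  Lnorm P r%:E (EFin \o f) = (moment P r f `^ r^-1)%:E.
Proof.
move=> [_ iF]; rewrite unlock -poweR_EFin; congr (_ `^ _)%E.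
by rewrite -expect_EFin.
Qed.

Lemma Lnorm_le_moment r f (a : R) : 0 < r -> 0 <= a -> finite_moment P r f ->
  (Lnorm P r%:E (EFin \o f) <= a%:E)%E = (moment P r f <= a `^ r).
Proof.
move=> r0 a0 fr; rewrite Lnorm_moment// lee_fin; apply/idP/idP => H.
  rewrite -[leLHS](powR_invK r0) ?moment_ge0// ge0_ler_powR ?nnegrE ?powR_ge0//.
  exact: ltW.
have -> : a = (a `^ r) `^ r^-1 by rewrite -powRrM mulfV ?gt_eqF// powRr1.
by rewrite ge0_ler_powR ?nnegrE ?powR_ge0 ?moment_ge0// invr_ge0 ltW.
Qed.

Lemma moment_minkowski r f g (a b : R) : 1 <= r -> 0 <= a -> 0 <= b ->
  finite_moment P r f -> finite_moment P r g ->
  moment P r f <= a `^ r -> moment P r g <= b `^ r ->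
  moment P r (fun x => f x + g x) <= (a + b) `^ r.
Proof.
move=> r1 a0 b0 fr gr; have r0 : 0 < r by rewrite (lt_le_trans ltr01).
have fgr := finite_momentD (ltW r0) fr gr.
move=> fa gb.
have {}fa : (Lnorm P r%:E (EFin \o f) <= a%:E)%E by rewrite Lnorm_le_moment.
have {}gb : (Lnorm P r%:E (EFin \o g) <= b%:E)%E by rewrite Lnorm_le_moment.
rewrite -(Lnorm_le_moment r0 (addr_ge0 a0 b0) fgr). apply: (le_trans (minkowski_EFin P _ _ r1)); first by case: fr.
  by case: gr.
by rewrite EFinD leeD.
Qed.

End Lnorm_moment.

Section mixing.
Context {R : realType} {d} {T : measurableType d} (P : probability T R).
Implicit Types (f g h V W Y Z : T -> R) (p r : R) (G : set (set T)).

Local Notation L1 f := (P.-integrable [set: T] (EFin \o f)).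
Local Notation E f := (\int[P]_x f x).

Lemma expect_le_ae f g : L1 f -> L1 g -> (forall x, 0 <= f x) -> (forall x, 0 <= g x) ->
  {ae P, forall x, f x <= g x} -> E f <= E g.
Proof.
move=> iF iG f0 g0 fg; rewrite -lee_fin -!expect_EFin//.
apply: ae_ge0_le_integral => //.
- by move=> x _; rewrite lee_fin.
- exact: measurable_int iF.
- by move=> x _; rewrite lee_fin.
- exact: measurable_int iG.
- by apply: filterS fg => x fgx _; rewrite lee_fin.
Qed.

(** Jensen with phi(x) = max(0, |x| - K), which vanishes along [Z]: E phi(Y) <= 0 forces phi(Y) = 0
    almost surely. *)
Lemma cond_exp_bounded G Z Y (K : R) : <<s G >> `<=` measurable ->
  L1 Z -> (forall x, `|Z x| <= K) -> is_cond_exp P <<s G >> Z Y ->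
  {ae P, forall x, `|Y x| <= K}.
Proof.
move=> subG iZ ZK YZ.
pose phi (x : R) := Num.max 0 (`|x| - K).
pose psi (x : R) : R := \1_(`]K, +oo[%classic) x - \1_(`]-oo, (- K)[%classic) x.
have mphi : measurable_fun [set: R] phi.
  apply: measurable_maxr => //; apply: measurable_funB => //.
have mpsi : measurable_fun [set: R] psi.
  by apply: measurable_funB; exact: measurable_indic.
have phi0 x : 0 <= phi x by rewrite le_max lexx.
have phiZ : phi \o Z = fun=> 0.
  by apply/funext => x; apply/max_idPl; rewrite subr_le0.
(* A point of [T] yields 0 <= K, on which the tangent inequality for [phi] relies; on an empty [T]
   the claim is vacuous. *)
have [x0|noT] := pselect (exists x : T, True); last first.
  by apply: aeW => x; case: noT; exists x.
have K0 : 0 <= K by case: x0 => x _; exact: le_trans (ZK x).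
have [] := @cond_exp_jensen _ _ _ P G subG phi psi Z Y mphi mpsi phi0 _ _ iZ YZ _.
- move=> x y; rewrite /psi !indicE.
  rewrite !mem_setE !in_itv/= andbT.
  rewrite /phi; have yK : `|y| - K <= Num.max 0 (`|y| - K) by rewrite le_max lexx orbT.
  have [y1 y2] : y <= `|y| /\ - y <= `|y| by rewrite ler_norm -normrN ler_norm.
  have [xK|xK] := ltP K x.
    have xNK : (x < - K) = false by apply/negbTE; rewrite -leNgt; lra.
    rewrite xNK/= subr0 mul1r ger0_norm; last lra.
    by rewrite max_r; lra.
  have [xNK|xNK] := ltP x (- K).
    rewrite /= sub0r mulN1r ltr0_norm; last lra.
    by rewrite max_r; lra.
  rewrite /= subrr mul0r addr0 max_l ?phi0// subr_le0 ler_norml.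
  by apply/andP; split.
- move=> N; exists 2 => x _; rewrite /psi (le_trans (ler_normB _ _))//.
  by rewrite -[leRHS]/(1 + 1) lerD// normr_indic_le1.
- by rewrite phiZ; exact: integrable_const.
- move=> iY; rewrite phiZ expect_cst => EY.
  have {}EY : (\int[P]_x `|(phi (Y x))%:E| = 0)%E.
    under eq_integral do rewrite gee0_abs ?lee_fin//.
    rewrite (expect_EFin iY); congr (_%:E).
    by apply/le_anti; rewrite EY expect_ge0// => x; exact: phi0.
  have mY : measurable_fun [set: T] (EFin \o (phi \o Y)) by exact: measurable_int iY.
  have := (ae_eq_integral_abs P measurableT mY).1 EY.
  apply: filterS => x /(_ I)/= [] /eqP; rewrite eq_le => /andP[+ _].
  by rewrite ge_max lexx/= subr_le0.
Qed.

(** The event V >= 0 lies in the sub-sigma-algebra, so |V| splits over it and its complement, and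
    each piece costs [c]. *)
Lemma expect_norm_indic_le G V (c : R) : <<s G >> `<=` measurable ->
  measurable_fun [set: g_sigma_algebraType G] (V : g_sigma_algebraType G -> R) ->
  L1 V -> (forall A, <<s G >> A -> `|E (fun x => \1_A x * V x)| <= c) ->
  E (fun x => `|V x|) <= 2 * c.
Proof.
move=> subG mV iV Vc.
pose A := [set x | 0 <= V x].
have GA : <<s G >> A.
  have := mV measurableT _ (measurable_itv `[0, +oo[ ).
  rewrite setTI; congr (<<s G >> _).
  by apply/seteqP; split => x /=; rewrite in_itv/= andbT.
have GAC : <<s G >> (~` A) := @measurableC _ (g_sigma_algebraType G) _ GA.
have mA := subG _ GA; have mAC := subG _ GAC.
have -> : E (fun x => `|V x|) = E (fun x => \1_A x * V x) - E (fun x => \1_(~` A) x * V x).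
  rewrite -expectB; [|exact: integrable_indic_mul..].
  apply: eq_Rintegral => x _; rewrite !indicE in_setC.
  have [/set_mem xA|xA] := boolP (x \in A).
    by rewrite /= mul1r mul0r subr0 ger0_norm.
  rewrite /= mul0r mul1r sub0r ltr0_norm// ltNge.
  by apply: contra xA => xA; rewrite inE.
have := Vc _ GA; have := Vc _ GAC.
rewrite !ler_norml; move: (Rintegral _ _ _) (Rintegral _ _ _) => a b; clear; lra.
Qed.

Section two_sigma_algebras.
Variables (G1 G2 : set (set T)) (beta : R).
Hypothesis sub1 : <<s G1 >> `<=` measurable.
Hypothesis sub2 : <<s G2 >> `<=` measurable.
Hypothesis mix : forall A B, <<s G1 >> A -> <<s G2 >> B ->
  `|fine (P (A `&` B)) - fine (P A) * fine (P B)| <= beta.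

Local Notation G1meas f :=
  (measurable_fun [set: g_sigma_algebraType G1] (f : g_sigma_algebraType G1 -> R)).

Lemma indicI_mul (A B : set T) x : \1_(A `&` B) x = \1_A x * \1_B x :> R.
Proof. by rewrite !indicE in_setI; case: (x \in A); rewrite ?mul1r ?mul0r. Qed.

(** The covariance of [W] and the indicator of [B] is E(W C) for C = E[1_B - P(B) | G1]. Integrating
    C over an event A of the first sigma-algebra gives P(A and B) - P(A) P(B), so E|C| <= 2 beta.
    This passes from events to bounded functions without approximation by simple functions. *)
Lemma mixing_cov_indic W (M : R) B : G1meas W -> (forall x, `|W x| <= M) ->
  <<s G2 >> B -> `|E (fun x => \1_B x * (W x - E W))| <= 2 * M * beta.
Proof.
move=> mW WM GB; have mB := sub2 GB.
have mW' := sub_measurable_fun sub1 mW.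
have iW : L1 W := integrable_bounded P mW' WM.
have iB : L1 (\1_B) by exact: integrable_indic.
pose D x : R := \1_B x - fine (P B).
have iD : L1 D by apply: integrable_subr => //; exact: integrable_const.
have [C CD] := cond_exp_exists sub1 iD.
have [mC iC HC] := (cond_expP sub1 C iD).1 CD.
have -> : E (fun x => \1_B x * (W x - E W)) = E (fun x => W x * C x).
  rewrite (cond_exp_mul sub1 iD CD mW WM).
  have iBW := integrable_indic_mul mB iW.
  have -> : E (fun x => \1_B x * (W x - E W)) =
            E (fun x => \1_B x * W x) - E W * fine (P B).
    rewrite -(expect_indic P mB) -expectZ// -expectB//; last exact: integrable_scaler.
    by apply: eq_Rintegral => x _; rewrite mulrBr (mulrC (E W)).
  rewrite mulrC -expectZ// -expectB//; last exact: integrable_scaler.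
  by apply: eq_Rintegral => x _; rewrite mulrBr (mulrC (W x)) (mulrC (W x)).
have M0 : 0 <= M.
  have [[x _]|noT] := pselect (exists x : T, True); first exact: le_trans (WM x).
  have := expect_cst P 1; have -> : [set: T] = set0.
    by apply/seteqP; split=> x // _; apply: noT; exists x.
  by rewrite Rintegral_set0 => /esym/eqP; rewrite oner_eq0.
have iWC := integrable_bounded_mul mW' WM iC.
apply: le_trans (expect_norm_le iWC) _.
apply: (@le_trans _ _ (M * E (fun x => `|C x|))).
  rewrite -expectZ; last exact: integrable_normr.
  apply: expect_le; [exact: integrable_normr|exact/integrable_scaler/integrable_normr|].
  by move=> x; rewrite normrM ler_wpM2r.
rewrite -mulrA mulrCA ler_wpM2l//.
apply: (expect_norm_indic_le sub1 mC iC) => A GA; have mA := sub1 GA.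
rewrite HC//; apply: le_trans (mix GA GB); rewrite le_eqVlt; apply/orP; left; apply/eqP.
congr (`|_|); rewrite -(expect_indic P mA) -(expect_indic P (measurableI _ _ mA mB)).
have iA : L1 (\1_A) by exact: integrable_indic.
rewrite mulrC -expectZ// -expectB; last 2 first.
- exact: integrable_indic (measurableI _ _ mA mB).
- exact: integrable_scaler.
by apply: eq_Rintegral => x _; rewrite indicI_mul mulrBr (mulrC (fine _)).
Qed.

(** [expect_norm_indic_le] is used again, now over [G2]: the 4 is one factor 2 for each
    sigma-algebra. *)
Lemma mixing_cond_exp_L1 W V (M : R) : G1meas W -> (forall x, `|W x| <= M) ->
  is_cond_exp P <<s G2 >> (fun x => W x - E W) V ->
  E (fun x => `|V x|) <= 4 * M * beta.
Proof.
move=> mW WM VW.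
have iW : L1 W := integrable_bounded P (sub_measurable_fun sub1 mW) WM.
have iWE : L1 (fun x => W x - E W) by apply: integrable_subr => //; exact: integrable_const.
have [mV iV HV] := (cond_expP sub2 V iWE).1 VW.
rewrite (_ : 4 * M * beta = 2 * (2 * M * beta)); last by rewrite !mulrA -natrM.
by apply: (expect_norm_indic_le sub2 mV iV) => B GB; rewrite HV//; exact: mixing_cov_indic.
Qed.

End two_sigma_algebras.

End mixing.

(** * Mixing bounds in L_r by truncation *)

Section mixing_moments.
Context {R : realType} {d} {T : measurableType d} (P : probability T R).
Variables (G1 G2 : set (set T)) (beta : R).
Hypothesis sub1 : <<s G1 >> `<=` measurable.
Hypothesis sub2 : <<s G2 >> `<=` measurable.
Hypothesis beta0 : 0 < beta.
Hypothesis mix : forall A B, <<s G1 >> A -> <<s G2 >> B ->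
  `|fine (P (A `&` B)) - fine (P A) * fine (P B)| <= beta.

Local Notation L1 f := (P.-integrable [set: T] (EFin \o f)).
Local Notation E f := (\int[P]_x f x).
Local Notation G1meas f :=
  (measurable_fun [set: g_sigma_algebraType G1] (f : g_sigma_algebraType G1 -> R)).

(** Almost surely |V| <= 2 M, so |V|^r <= (2 M)^(r - 1) |V|; with E|V| <= 4 M beta, the r-th moment
    is at most (4 M)^r beta. *)
Lemma mixing_bounded_moment (W V : T -> R) (M r : R) : 1 <= r -> 0 < M ->
  G1meas W -> (forall x, `|W x| <= M) ->
  is_cond_exp P <<s G2 >> (fun x => W x - E W) V ->
  finite_moment P r V /\ moment P r V <= (4 * (M * beta `^ r^-1)) `^ r.
Proof.
move=> r1 M0 mW WM VW; have r0 : 0 < r by rewrite (lt_le_trans ltr01).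
have iW : L1 W := integrable_bounded P (sub_measurable_fun sub1 mW) WM.
have iWE : L1 (fun x => W x - E W) by apply: integrable_subr => //; exact: integrable_const.
have EWM : `|E W| <= M.
  rewrite (le_trans (expect_norm_le iW))// -[leRHS](expect_cst P).
  by apply: expect_le => //; [exact: integrable_normr|exact: integrable_const].
have WEM x : `|W x - E W| <= 2 * M.
  by rewrite (le_trans (ler_normB _ _))// mulr2n mulrDl mul1r lerD.
have aeV := cond_exp_bounded sub2 iWE WEM VW.
have EV := mixing_cond_exp_L1 sub1 sub2 mix mW WM VW.
have WEr : finite_moment P r (fun x => W x - E W).
  apply: (finite_moment_dominated (integrable_measurable iWE) (integrable_const P ((2 * M) `^ r))).
  by move=> x; rewrite ge0_ler_powR ?nnegrE ?mulr_ge0 ?(ltW M0) ?(ltW r0).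
have [Vr _] := cond_exp_moment sub2 r1 WEr VW; split=> //.
have iV := finite_moment_integrable r1 Vr.
have M20 : 0 <= 2 * M by rewrite mulr_ge0 ?ltW.
apply: (@le_trans _ _ ((2 * M) `^ (r - 1) * E (fun x => `|V x|))).
  rewrite -expectZ; last exact: integrable_normr.
  apply: expect_le_ae; [by case: Vr|exact/integrable_scaler/integrable_normr| | |].
  - by move=> x; exact: powR_ge0.
  - by move=> x; rewrite mulr_ge0 ?powR_ge0.
  - apply: filterS aeV => x Vx.
    rewrite -mulr_powRB1// mulrC ler_wpM2r// ge0_ler_powR ?nnegrE ?subr_ge0//.
rewrite mulrA (@powRM _ (4 * M)) ?powR_ge0 ?mulr_ge0 ?(ltW M0)// powR_invK ?(ltW beta0)//.
apply: (le_trans (ler_wpM2l (powR_ge0 _ _) EV)); rewrite mulrA ler_pM2r//.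
rewrite -(@mulr_powRB1 _ (4 * M)) ?mulr_ge0 ?(ltW M0)// mulrC ler_wpM2l ?mulr_ge0 ?(ltW M0)//.
by rewrite ge0_ler_powR ?nnegrE ?subr_ge0 ?mulr_ge0 ?(ltW M0)// ler_pM2r// ler_nat.
Qed.

(** Where |W| > M, one has |W|^r <= M^(r - p) |W|^p, and by the bound on the p-th moment this
    integrates to at most M^r beta. *)
Lemma truncation_moment (W : T -> R) (M r p : R) : 1 <= r < p -> 0 < M ->
  finite_moment P p W -> moment P p W <= M `^ p * beta ->
  let W2 x := W x - \1_[set x | `|W x| <= M] x * W x in
  finite_moment P r W2 /\ moment P r W2 <= (M * beta `^ r^-1) `^ r.
Proof.
move=> /andP[r1 rp] M0 Wp Wbeta W2; have r0 : 0 < r by rewrite (lt_le_trans ltr01).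
have p0 : 0 < p by rewrite (lt_trans r0).
have Mp0 : 0 < M `^ p by rewrite powR_gt0.
have Mr0 : 0 < M `^ r by rewrite powR_gt0.
have [mW iWp] := Wp.
have mB : measurable [set x | `|W x| <= M].
  rewrite (_ : [set x | _] = W @^-1` `[- M, M]).
    by rewrite -[X in measurable X]setTI; exact: mW.
  by apply/seteqP; split => x; rewrite /= in_itv/= ler_norml.
have pw x : `|W2 x| `^ r <= M `^ r / M `^ p * `|W x| `^ p.
  rewrite /W2 indicE; have [xB|] := boolP (x \in _).
    by rewrite mul1r subrr normr0 powR0 ?gt_eqF// mulr_ge0 ?powR_ge0// divr_ge0 ?powR_ge0.
  rewrite notin_setE/= => /negP; rewrite -ltNge => WM.
  have W0 : 0 < `|W x| by rewrite (lt_trans M0).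
  rewrite mul0r subr0 -mulrA [leRHS]mulrC -ler_pdivrMr// [leRHS]mulrC.
  have pd a : `|W x| `^ a / M `^ a = (`|W x| / M) `^ a.
    apply/esym; apply: (mulIf (lt0r_neq0 (powR_gt0 a M0))).
    by rewrite -powRM ?divr_ge0 ?(ltW M0)// !divfK ?gt_eqF ?powR_gt0.
  rewrite !pd; apply: ler_powR; last exact: ltW.
  by rewrite ler_pdivlMr// mul1r ltW.
have mW2 : measurable_fun [set: T] W2.
  by apply: measurable_funB => //; apply: measurable_funM => //; exact: measurable_indic.
have iS := integrable_scaler (M `^ r / M `^ p) iWp.
have W2r : finite_moment P r W2 by exact: finite_moment_dominated iS pw.
split=> //; have [_ iW2] := W2r.
apply: (le_trans (expect_le iW2 iS pw)); rewrite expectZ// -/(moment P p W).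
rewrite (@powRM _ M) ?powR_ge0 ?(ltW M0)// powR_invK ?(ltW beta0)// -mulrA ler_pM2l//.
by rewrite ler_pdivrMl.
Qed.

(** Let W1 be the bounded part of W and W2 = W - W1. Then [V] is the sum of the conditional
    expectations of W1 - E W1, which costs 4 m, and of W2 + E W1, which costs 2 m since E W = 0
    gives |E W1| = |E W2| <= m. *)
Lemma mixing_cond_exp_moment (W V : T -> R) (M r p : R) : 1 <= r < p -> 0 < M ->
  G1meas W -> finite_moment P p W -> E W = 0 ->
  moment P p W <= M `^ p * beta -> is_cond_exp P <<s G2 >> W V ->
  moment P r V <= (6 * (M * beta `^ r^-1)) `^ r.
Proof.
move=> rp M0 mW Wp EW0 Wbeta VW; have /andP[r1 rltp] := rp.
have r0 : 0 < r by rewrite (lt_le_trans ltr01).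
have p1 : 1 <= p by rewrite (le_trans r1)// ltW.
set m := M * beta `^ r^-1.
have m0 : 0 <= m by rewrite mulr_ge0 ?powR_ge0 ?ltW.
have [W2r leW2] := truncation_moment rp M0 Wp Wbeta.
pose B := [set x | `|W x| <= M].
pose W1 x := \1_B x * W x.
have GB : <<s G1 >> B.
  have := mW measurableT _ (measurable_itv `[- M, M]).
  rewrite setTI; congr (<<s G1 >> _).
  by apply/seteqP; split => x; rewrite /B/= in_itv/= ler_norml.
have mW1 : G1meas W1.
  by apply: measurable_funM => //; exact: (@measurable_indic _ (g_sigma_algebraType G1)).
have W1M x : `|W1 x| <= M.
  rewrite /W1 indicE; have [/set_mem xB|_] := boolP (x \in B); first by rewrite mul1r.
  by rewrite mul0r normr0 ltW.
have iW := finite_moment_integrable p1 Wp.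
have iW1 : L1 W1 := integrable_bounded P (sub_measurable_fun sub1 mW1) W1M.
have iW1E : L1 (fun x => W1 x - E W1) by apply: integrable_subr => //; exact: integrable_const.
have [V1 V1W1] := cond_exp_exists sub2 iW1E.
have [V1r leV1] := mixing_bounded_moment r1 M0 mW1 W1M V1W1.
have V2W2 := cond_expB sub2 iW iW1E VW V1W1.
have EW1 : `|E W1| <= m.
  have iW2 := finite_moment_integrable r1 W2r.
  have -> : E W1 = - E (fun x => W x - W1 x) by rewrite expectB// EW0 sub0r opprK.
  rewrite normrN (le_trans (expect_norm_le iW2))//.
  have := @moment_le_powR _ _ _ P 1 r _ m _ m0 W2r leW2.
  rewrite ltr01 r1 powRr1// => /(_ isT); apply: le_trans.
  by rewrite le_eqVlt; apply/orP; left; apply/eqP; apply: eq_Rintegral => x _; rewrite powRr1.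
have cr : finite_moment P r (fun=> E W1) by exact: finite_moment_cst.
have lecr : moment P r (fun=> E W1) <= m `^ r.
  by rewrite /moment expect_cst ge0_ler_powR ?nnegrE// ltW.
have WE : (fun x => W x - (W1 x - E W1)) = (fun x => W x - W1 x + E W1).
  by apply/funext => x; rewrite opprB addrA addrAC.
rewrite WE in V2W2.
have Wr := finite_momentD (ltW r0) W2r cr.
have [V2r leV2] := cond_exp_moment sub2 r1 Wr V2W2.
have {}leV2 := le_trans leV2 (moment_minkowski r1 m0 m0 W2r cr leW2 lecr).
have -> : V = fun x => V1 x + (V x - V1 x) by apply/funext => x; rewrite subrKC.
have -> : 6 * m = 4 * m + (m + m) by ring.
have m40 : 0 <= 4 * m by rewrite mulr_ge0.
have m20 : 0 <= m + m by rewrite addr_ge0.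
exact: (moment_minkowski r1 m40 m20 V1r V2r leV1 leV2).
Qed.

End mixing_moments.

(** * Filtrations *)

Section filtration.
Context {R : realType} {d} {T : measurableType d} (P : probability T R).
Implicit Types (G H : set (set T)) (Y Z : T -> R) (p r : R).

Local Notation L1 f := (P.-integrable [set: T] (EFin \o f)).
Local Notation E f := (\int[P]_x f x).

Lemma cond_exp_tower G H Z Y V : <<s G >> `<=` measurable -> <<s H >> `<=` measurable ->
  <<s H >> `<=` <<s G >> -> L1 Z -> is_cond_exp P <<s G >> Z Y ->
  is_cond_exp P <<s H >> Z V -> is_cond_exp P <<s H >> Y V.
Proof.
move=> subG subH HG iZ YZ /(cond_expP subH _ iZ)[mV iV HV].
have [_ iY _] := YZ.
apply/cond_expP => //; split=> // A HA.
by rewrite HV// (cond_exp_indic subG iZ YZ)//; exact: HG.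
Qed.

Lemma exists_small_increment (G : nat -> set (set T)) (Y : nat -> T -> R) p Z m :
  (forall i, <<s G i >> `<=` measurable) -> (forall i, <<s G i >> `<=` <<s G i.+1 >>) ->
  1 < p <= 2 -> finite_moment P p Z -> (forall i, is_cond_exp P <<s G i >> Z (Y i)) ->
  (0 < m)%N ->
  exists2 i, (i < m)%N &
    (p - 1) * m%:R * sqnorm P p (fun x => Y i.+1 x - Y i x) <= sqnorm P p Z.
Proof.
move=> subG incG p12 Zp YZ m0; have /andP[p1 p2] := p12.
have p0 : 0 < p by rewrite (lt_trans ltr01).
have iZ := finite_moment_integrable (ltW p1) Zp.
have Yp i := (cond_exp_moment (subG i) (ltW p1) Zp (YZ i)).1.
pose a i := (p - 1) * sqnorm P p (fun x => Y i.+1 x - Y i x).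
(* Uniform convexity between [Y j] and [Y j.+1] pays for each new term, so the squared norm of the
   current [Y j] dominates the partial sum. *)
have sumle j : \sum_(0 <= i < j) a i <= sqnorm P p (Y j).
  elim: j => [|j IH]; first by rewrite big_geq// sqnorm_ge0.
  rewrite (big_nat_recr _ _ _ (leq0n j)).
  have Yj := cond_exp_tower (subG j.+1) (subG j) (incG j) iZ (YZ j.+1) (YZ j).
  have := cond_exp_sqnorm (subG j) p12 (Yp j.+1) Yj; rewrite -/(a j).
  exact: le_trans (lerD IH (lexx (a j))).
have sumZ : \sum_(0 <= i < m) a i <= sqnorm P p Z.
  apply: le_trans (sumle m) _.
  have [_ leY] := cond_exp_moment (subG m) (ltW p1) Zp (YZ m).
  by rewrite ge0_ler_powR ?nnegrE ?moment_ge0// divr_ge0// ltW.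
apply: contrapT => noi.
have big i : (0 <= i < m)%N -> sqnorm P p Z / m%:R < a i.
  move=> /andP[_ im]; rewrite ltNge; apply/negP => ai; apply: noi; exists i => //.
  by rewrite mulrAC -ler_pdivlMr ?ltr0n.
have := ltr_sum_nat m0 big; rewrite ltNge => /negP; apply.
rewrite sumr_const_nat subn0 -(mulr_natr (sqnorm P p Z / m%:R)) divfK//.
by rewrite pnatr_eq0 -lt0n.
Qed.

(** [G i] stands for the past and [H i] for the block that follows it, contained in the next past.
    Arrays enter only through these inclusions and the mixing bound. *)
Lemma exists_cond_exp_close (G H : nat -> set (set T)) p Z (beta : R) m :
  (forall i, <<s G i >> `<=` measurable) -> (forall i, <<s G i >> `<=` <<s G i.+1 >>) ->
  (forall i, <<s H i >> `<=` <<s G i.+1 >>) ->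
  0 < beta ->
  (forall i, (i < m)%N -> forall A B, <<s G i >> A -> <<s H i >> B ->
    `|fine (P (A `&` B)) - fine (P A) * fine (P B)| <= beta) ->
  1 < p <= 2 -> finite_moment P p Z -> E Z = 0 -> (0 < m)%N ->
  let sigma := moment P p Z `^ p^-1 in
  exists2 i, (i < m)%N & forall r, 1 <= r < p ->
    forall Y, is_cond_exp P <<s H i >> Z Y -> finite_moment P r Y /\
      moment P r Y <= (Num.sqrt ((p - 1)^-1 / m%:R) * sigma
                       + 6 * (sigma * beta `^ (r^-1 - p^-1))) `^ r.
Proof.
move=> subG incG HG beta0 mix p12 Zp EZ m0 sigma; have /andP[p1 p2] := p12.
have p0 : 0 < p by rewrite (lt_trans ltr01).
have p10 : 0 < p - 1 by rewrite subr_gt0.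
have mR0 : 0 < m%:R :> R by rewrite ltr0n.
have iZ := finite_moment_integrable (ltW p1) Zp.
have [W WZ] := choice (fun i => cond_exp_exists (subG i) iZ).
have [i im di] := exists_small_increment subG incG p12 Zp WZ m0.
exists i => // r /andP[r1 rp] Y YZ.
have r0 : 0 < r by rewrite (lt_le_trans ltr01).
have rple : 0 < r <= p by rewrite r0 ltW.
have subH : <<s H i >> `<=` measurable.
  by move=> A HA; exact: (subG i.+1) _ (HG i _ HA).
have sigma0 : 0 <= sigma by exact: powR_ge0.
have sigmap : sigma `^ p = moment P p Z by rewrite powR_invK ?moment_ge0.
set c := Num.sqrt _.
have c0 : 0 <= c by exact: sqrtr_ge0.
have [Wp leW] := cond_exp_moment (subG i) (ltW p1) Zp (WZ i).
have [Wp1 _] := cond_exp_moment (subG i.+1) (ltW p1) Zp (WZ i.+1).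
have iW := finite_moment_integrable (ltW p1) Wp.
have iW1 := finite_moment_integrable (ltW p1) Wp1.
have YW1 := cond_exp_tower (subG i.+1) subH (HG i) iZ (WZ i.+1) YZ.
have [V VW] := cond_exp_exists subH iW.
have dp := finite_momentB (ltW p0) Wp1 Wp.
(* [Y - V] is the conditional expectation of the increment [W i.+1 - W i] given [H i], hence no
   larger in L_p. *)
have DW := cond_expB subH iW1 iW YW1 VW.
have [Dp leD] := cond_exp_moment subH (ltW p1) dp DW.
have Dr : finite_moment P r (fun x => Y x - V x).
  by apply: finite_moment_le Dp; rewrite (ltW r0) ltW.
have [Vp leV] := cond_exp_moment subH (ltW p1) Wp VW.
have Vr : finite_moment P r V.
  by apply: finite_moment_le Vp; rewrite (ltW r0) ltW.
have momD : moment P r (fun x => Y x - V x) <= (c * sigma) `^ r.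
  apply: (moment_le_powR rple _ Dp); first exact: mulr_ge0.
  apply: (le_trans leD).
  rewrite -(sqnorm_powR P _ p0).
  have -> : (c * sigma) `^ p = ((c * sigma) ^+ 2) `^ (p / 2).
    rewrite -powR_mulrn ?mulr_ge0// -powRrM; congr (_ `^ _).
    by rewrite mulrC divfK// pnatr_eq0.
  rewrite ge0_ler_powR ?nnegrE ?sqnorm_ge0 ?sqr_ge0 ?divr_ge0 ?(ltW p0)//.
  rewrite exprMn sqr_sqrtr; last by rewrite divr_ge0 ?invr_ge0 ?ltW.
  have -> : sigma ^+ 2 = sqnorm P p Z by rewrite -powR_mulrn// -powRrM mulrC.
  by rewrite -invfM [leRHS]mulrC ler_pdivlMr ?mulr_gt0// mulrC.
have momV : moment P r V <= (6 * (sigma * beta `^ (r^-1 - p^-1))) `^ r.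
  (* For [sigma = 0] the truncation height would be 0, but then the p-th moment of [V] is 0. *)
  have [sigma00|sigma00] := eqVneq sigma 0.
    rewrite sigma00 mul0r mulr0 -[X in X `^ r]sigma00.
    apply: (moment_le_powR rple sigma0 Vp).
    by rewrite sigmap; exact: le_trans leV leW.
  have sigma_gt0 : 0 < sigma by rewrite lt0r sigma00.
  have -> : sigma * beta `^ (r^-1 - p^-1) = sigma * beta `^ (- p^-1) * beta `^ r^-1.
    rewrite -mulrA -powRD; last by rewrite (gt_eqF beta0) implybT.
    by rewrite (addrC (- p^-1)).
  (* The truncation height: its p-th power times [beta] is the p-th moment of [Z]. *)
  have M0 : 0 < sigma * beta `^ (- p^-1) by rewrite mulr_gt0// powR_gt0.
  have r1p : 1 <= r < p by rewrite r1.
  apply: (mixing_cond_exp_moment (subG i) subH beta0 (mix i im) r1p M0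
    (cond_exp_measurable (WZ i)) Wp _ _ VW).
  - by rewrite (cond_exp_expect (subG i) iZ (WZ i)).
  - rewrite powRM ?powR_ge0// sigmap -powRrM mulNr mulVf ?gt_eqF//.
    by rewrite powR_inv1 ?(ltW beta0)// divfK ?gt_eqF.
have YE : Y = fun x => (Y x - V x) + V x by apply/funext => x; rewrite subrK.
have c1 : 0 <= c * sigma by exact: mulr_ge0.
have c2 : 0 <= 6 * (sigma * beta `^ (r^-1 - p^-1)) by rewrite !mulr_ge0 ?powR_ge0.
rewrite YE; split; first by apply: finite_momentD => //; exact: ltW.
exact: (moment_minkowski r1 c1 c2 Dr Vr momD momV).
Qed.

End filtration.

(** * Blocks of consecutive elements *)

Section ranks.
Variable n : nat.
Implicit Types (I : {set 'I_n}) (x y : 'I_n).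

(** On [I] this is the position in increasing order, counted from 0; [initial I j] thus collects the
    j smallest elements, and blocks are differences of two such sets. *)
Definition rank I x := #|[set y in I | (y < x)%N]%SET|.
Definition initial I j := [set x in I | (rank I x < j)%N]%SET.

Lemma rank_le I x y : (x <= y)%N -> (rank I x <= rank I y)%N.
Proof.
move=> xy; apply/subset_leq_card/fintype.subsetP => z; rewrite !inE => /andP[-> /=].
by move=> /leq_trans; apply.
Qed.

Lemma rank_lt I x y : x \in I -> (x < y)%N -> (rank I x < rank I y)%N.
Proof.
move=> xI xy; rewrite /rank; apply/proper_card/fintype.properP; split.
  apply/fintype.subsetP => z; rewrite !inE => /andP[-> /=] zx.
  exact: ltn_trans xy.
by exists x; rewrite !inE ?xI ?xy// ltnn andbF.
Qed.

Lemma rank_lt_card I x : x \in I -> (rank I x < #|I|)%N.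
Proof.
move=> xI; rewrite /rank; apply/proper_card/fintype.properP; split.
  by apply/fintype.subsetP => z; rewrite inE => /andP[].
by exists x; rewrite ?inE ?ltnn ?andbF.
Qed.

(** On [I] the rank is injective with values below [#|I|], so the ranks are a permutation of
    [iota 0 #|I|], of which exactly j lie below j. *)
Lemma card_initial I j : (j <= #|I|)%N -> #|initial I j| = j.
Proof.
move=> jI; have inj : {in I &, injective (rank I)}.
  move=> x y xI yI xy; apply/val_inj/eqP; rewrite eqn_leq.
  by apply/andP; split; rewrite leqNgt; apply/negP;
    [move/(rank_lt yI)|move/(rank_lt xI)]; rewrite xy ltnn.
pose s := [seq rank I x | x <- enum I].
have us : uniq s.
  by rewrite map_inj_in_uniq ?enum_uniq// => x y; rewrite !fintype.mem_enum; exact: inj.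
have ss : {subset s <= iota 0 #|I|}.
  move=> k /mapP[x]; rewrite fintype.mem_enum => xI ->.
  by rewrite mem_iota add0n rank_lt_card.
have sz : (size (iota 0 #|I|) <= size s)%N by rewrite size_map size_iota -cardE.
have [_ eqs] := uniq_min_size us ss sz.
have ps := uniq_perm us (iota_uniq _ _) eqs.
have -> : #|initial I j| = count (fun k => k < j)%N s.
  rewrite count_map cardE -size_filter; apply/perm_size/uniq_perm.
  - exact: enum_uniq.
  - by rewrite filter_uniq// enum_uniq.
  - by move=> x; rewrite [RHS]mem_filter !fintype.mem_enum inE andbC.
have /permP -> := ps.
rewrite -(subnKC jI) iotaD count_cat add0n.
rewrite (eq_in_count (a2 := xpredT)); last by move=> k; rewrite mem_iota.
rewrite count_predT size_iota (eq_in_count (a2 := pred0)) ?count_pred0 ?addn0//.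
by move=> k; rewrite mem_iota => /andP[jk _]; rewrite ltnNge jk.
Qed.

Lemma subset_initial I j k : (j <= k)%N -> initial I j \subset initial I k.
Proof.
move=> jk; apply/fintype.subsetP => x; rewrite !inE => /andP[-> /=].
by move=> /leq_trans; apply.
Qed.

Lemma initial0 I : initial I 0 = finset.set0.
Proof. by apply/setP => x; rewrite !inE ltn0 andbF. Qed.

Lemma initial_lt I j k x y : x \in initial I j -> y \in initial I k :\: initial I j ->
  (x < y)%N.
Proof.
rewrite !inE => /andP[xI xj] /andP[+ /andP[yI yk]]; rewrite yI/= -leqNgt => jy.
rewrite ltnNge; apply/negP => /(rank_le I) yx.
by have := leq_trans xj (leq_trans jy yx); rewrite ltnn.
Qed.

Lemma int_interval_initialD I j k : int_interval I ->
  int_interval (initial I k :\: initial I j).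
Proof.
move=> Iint x y z; rewrite !inE => /andP[+ /andP[xI xk]] /andP[+ /andP[zI zk]] xy yz.
rewrite xI zI/= -!leqNgt => jx jz.
have yI := Iint x y z xI zI xy yz.
rewrite yI/= -leqNgt (leq_trans jx (rank_le I xy))/=.
exact: leq_ltn_trans (rank_le I yz) zk.
Qed.

Lemma card_initialD I j k : (j <= k)%N -> (k <= #|I|)%N ->
  #|initial I k :\: initial I j| = (k - j)%N.
Proof.
move=> jk kI; rewrite cardsD (finset.setIidPr (subset_initial I jk)).
by rewrite !card_initial// (leq_trans jk).
Qed.

End ranks.

(** * Random arrays *)

Section array_sigma_algebras.
Context {dT : measure_display} {T : measurableType dT} {dX : measure_display}
  {Xsp : measurableType dX} {n d : nat} (X : dsub n d -> T -> Xsp).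

(** The generators of [FJ X J], kept apart because the results on conditional expectations are
    parametrised by a generating family. *)
Definition FJ_gen (J : {set 'I_n}) : set (set T) :=
  \bigcup_(s in [set s : dsub n d | val s \subset J])
    preimage_set_system setT (X s) measurable.

Lemma FJ_measurable (J : {set 'I_n}) : (forall s, measurable_fun setT (X s)) ->
  <<s FJ_gen J >> `<=` measurable.
Proof.
move=> mX; apply: smallest_sub; first exact: sigma_algebra_measurable.
by move=> A [s _ [B mB <-]]; exact: mX.
Qed.

Lemma subset_FJ (J K : {set 'I_n}) : J \subset K -> <<s FJ_gen J >> `<=` <<s FJ_gen K >>.
Proof.
move=> JK; apply: sub_sigma_algebra2 => A [s sJ sA].
by exists s => //=; exact: fintype.subset_trans sJ JK.
Qed.

(** As d > 0, the empty set has no d-element subset, so there is no generator and the sigma-algebra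
    is trivial. *)
Lemma FJ_set0 (A : set T) : (0 < d)%N -> <<s FJ_gen finset.set0 >> A -> A = set0 \/ A = setT.
Proof.
move=> d0; move: A; apply: smallest_sub.
  split=> [|A [->|->]|F FT]; first by left.
  - by right; rewrite setD0.
  - by left; rewrite setDv.
  - have [[k Fk]|noT] := pselect (exists k, F k = setT).
      by right; apply/seteqP; split=> // x _; exists k => //; rewrite Fk.
    left; apply/seteqP; split=> // x [k _]; have [->//|FkT] := FT k.
    by case: noT; exists k.
move=> A [s /= s0]; have := valP s; rewrite finset.subset0 in s0.
by rewrite /= (eqP s0) cards0 eq_sym gtn_eqF.
Qed.

Lemma array_measurable_fun {R : realType} (f : (dsub n d -> Xsp) -> R) :
  (forall s, measurable_fun setT (X s)) -> prod_measurable f ->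
  measurable_fun setT (fun t => f (fun s => X s t)).
Proof.
move=> mX mf _ B mB; rewrite setTI.
pose phi t s := X s t.
suff H (C : set (dsub n d -> Xsp)) : @prod_sigma n d dX Xsp C -> measurable (phi @^-1` C).
  exact: (H (f @^-1` B) (mf B mB)).
move: C; apply: smallest_sub.
  split=> [|C mC|F mF].
  - by rewrite preimage_set0.
  - by rewrite setTD preimage_setC; exact: measurableC.
  - by rewrite preimage_bigcup; exact: bigcupT_measurable.
move=> C [s _ [D mD <-]]; rewrite setTI.
by have := mX s measurableT D mD; rewrite setTI.
Qed.

End array_sigma_algebras.

Unset Implicit Arguments.

Theorem theorem2p3 (R : realType) (dT : measure_display) (T : measurableType dT)
  (P : probability T R) (dX : measure_display) (Xsp : measurableType dX)
  (d l n : nat) (beta : R) (X : dsub n d -> T -> Xsp) :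
  (0 < d)%N -> (2 * d <= l)%N -> (l <= n)%N -> 0 < beta <= 1 ->
  (forall s, measurable_fun setT (X s)) ->
  dissociated P X beta l ->
  forall p : R, 1 < p <= 2 ->
  forall f : (dsub n d -> Xsp) -> R, prod_measurable f ->
  let Z := fun t => f (fun s => X s t) in
  (Lnorm P p%:E (EFin \o Z) < +oo)%E ->
  let EZ := fine (\int[P]_t (Z t)%:E) in
  forall k : nat, (d <= k)%N -> (k <= l./2)%N ->
  forall I : {set 'I_n}, #|I| = l ->
  exists J : {set 'I_n},
    [/\ J \subset I, #|J| = k, (int_interval I -> int_interval J) &
      forall r : R, 1 <= r < p ->
      forall Y : T -> R, is_cond_exp P (FJ X J) Z Y ->
      (Lnorm P r%:E (fun t => (Y t - EZ)%:E) <=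
        ((p - 1) `^ (- 2^-1) * Num.sqrt (2 * k%:R / l%:R)
          + 10 * beta `^ (r^-1 - p^-1))%:E
        * Lnorm P p%:E (fun t => (Z t - EZ)%:E))%E].

Proof.
move=> d0 dl ln beta01 mX diss p p12 f mf Z Zfin EZ k dk kl I cI.
have /andP[beta0 beta1] := beta01; have /andP[p1 p2] := p12.
have p0 : 0 < p by rewrite (lt_trans ltr01).
have k0 : (0 < k)%N by exact: leq_trans dk.
have k2l : (2 * k <= l)%N by rewrite mul2n -geq_half_double.
have kl' : (k <= l)%N by apply: leq_trans k2l; rewrite mul2n -addnn leq_addl.
pose m := (l %/ k)%N.
have m0 : (0 < m)%N by rewrite divn_gt0.
have mkl : (m * k <= l)%N by exact: leq_trunc_div.
pose K i := initial I (i * k).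
pose J i := K i.+1 :\: K i.
have mulk i : (i * k <= i.+1 * k)%N by rewrite leq_mul2r leqnSn orbT.
have ikl i : (i < m)%N -> (i.+1 * k <= #|I|)%N.
  by move=> im; rewrite cI (leq_trans _ mkl)// leq_mul2r im orbT.
have cJ i : (i < m)%N -> #|J i| = k.
  by move=> im; rewrite card_initialD ?ikl// -mulnBl subSnn mul1n.
have JK i : J i \subset K i.+1 by exact: finset.subsetDl.
have mZ : measurable_fun setT Z by exact: array_measurable_fun.
have Zp : finite_moment P p Z.
  split=> //; apply: (@Lfun_integrable _ _ _ P Z p (ltW p1)).
  by rewrite inE; apply/andP; split; rewrite inE.
have iZ := finite_moment_integrable (ltW p1) Zp.
pose Z0 t := Z t - EZ.
have Z0p : finite_moment P p Z0.
  by apply: finite_momentB (ltW p0) Zp _; exact: finite_moment_cst.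
have EZ0 : \int[P]_t (Z0 t) = 0.
  by rewrite expectB ?expect_cst ?subrr//; exact: integrable_const.
have subF B : <<s FJ_gen X B >> `<=` measurable by exact: FJ_measurable.
have mix i : (i < m)%N -> forall A B, <<s FJ_gen X (K i) >> A -> <<s FJ_gen X (J i) >> B ->
    `|fine (P (A `&` B)) - fine (P A) * fine (P B)| <= beta.
  (* Dissociation asks for at least [d] elements on each side, and [K 0] is empty; its events are
     trivial, hence independent of all others. *)
  case: i => [|i] im A B FA FB.
    rewrite /K mul0n initial0 in FA.
    have [->|->] := FJ_set0 d0 FA.
      by rewrite set0I measure0/= mul0r subrr normr0 ltW.
    rewrite setTI (_ : fine (P setT) = 1); last exact: (congr1 fine (probability_setT P)).
    by rewrite mul1r subrr normr0 ltW.
  have cK : #|K i.+1| = (i.+1 * k)%N by rewrite card_initial// (leq_trans (mulk _)) ?ikl.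
  apply: (diss (K i.+1) (J i.+1)) => //.
  - by rewrite cK (leq_trans dk)// leq_pmull.
  - by rewrite cJ.
  (* Together the two sets have i.+2 * k elements, at most [l] because i.+1 < m. *)
  - by rewrite cK cJ// -mulSnr -cI ikl.
  - by move=> a b aK bJ; exact: initial_lt bJ.
have [i im HJ] := @exists_cond_exp_close _ _ _ P (fun i => FJ_gen X (K i))
  (fun i => FJ_gen X (J i)) p Z0 beta m (fun i => subF (K i))
  (fun i => @subset_FJ _ _ _ _ _ _ X _ _ (subset_initial I (mulk i))) (fun i => @subset_FJ _ _ _ _ _ _ X _ _ (JK i))
  beta0 mix p12 Z0p EZ0 m0.
exists (J i); split.
- by apply: fintype.subset_trans (JK i) _; apply/fintype.subsetP => x; rewrite inE => /andP[].
- exact: cJ.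
- exact: int_interval_initialD.
move=> r r1p Y YZ; have /andP[r1 rp] := r1p.
have r0 : 0 < r by rewrite (lt_le_trans ltr01).
have YZ0 : is_cond_exp P <<s FJ_gen X (J i) >> Z0 (fun t => Y t - EZ).
  apply: (cond_expB (subF (J i)) iZ _ YZ); first exact: integrable_const.
  exact: (cond_exp_cst P (subF (J i))).
have [Yr leY] := HJ r r1p _ YZ0.
have -> : Lnorm P p%:E (fun t => (Z t - EZ)%:E) = (moment P p Z0 `^ p^-1)%:E.
  exact: Lnorm_moment.
rewrite -EFinM; set sigma := moment P p Z0 `^ p^-1 in leY *.
have sigma0 : 0 <= sigma by exact: powR_ge0.
have kR0 : 0 < k%:R :> R by rewrite ltr0n.
have lR0 : 0 < l%:R :> R by rewrite ltr0n (leq_trans k0).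
have mR0 : 0 < m%:R :> R by rewrite ltr0n.
have p10 : 0 < p - 1 by rewrite subr_gt0.
have coef0 : 0 <= (p - 1) `^ (- 2^-1) * Num.sqrt (2 * k%:R / l%:R) + 10 * beta `^ (r^-1 - p^-1).
  by rewrite addr_ge0 ?mulr_ge0 ?powR_ge0 ?sqrtr_ge0.
(* This rests on l < (m + 1) k <= 2 m k, as m >= 1. *)
have sqrt_le : Num.sqrt ((p - 1)^-1 / m%:R) <= (p - 1) `^ (- 2^-1) * Num.sqrt (2 * k%:R / l%:R).
  rewrite powRN powR12_sqrt ?(ltW p10)// -sqrtrV ?(ltW p10)// -sqrtrM ?invr_ge0 ?(ltW p10)//.
  rewrite ler_wsqrtr// ler_pM2l ?invr_gt0// ler_pdivlMr// mulrC ler_pdivrMr//.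
  rewrite -!natrM ler_nat; have := ltn_ceil l k0; rewrite -/m mulSn => lt_l.
  rewrite (leq_trans (ltnW lt_l))// -mulnA mul2n -addnn mulnC leq_add2r.
  by rewrite leq_pmulr.
rewrite (_ : (fun t => (Y t - EZ)%:E) = EFin \o (fun t => Y t - EZ))//.
rewrite Lnorm_le_moment ?mulr_ge0//.
apply: (le_trans leY); rewrite ge0_ler_powR ?nnegrE ?addr_ge0 ?mulr_ge0 ?sqrtr_ge0 ?powR_ge0 ?(ltW r0)//.
(* The increment terms compare by [sqrt_le], the mixing terms by 6 <= 10. *)
rewrite [leRHS]mulrDl lerD ?ler_wpM2r// mulrCA mulrC ler_wpM2r//.
by rewrite ler_wpM2r ?powR_ge0// ler_nat.
Qed.
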